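(* Let $X$ be a complex Banach space, $E=\ell^2(\mathbb Z,X)$, and let $A\in L(E)$ be tridiagonal. For all $n\in\mathbb N$, with $$\varepsilon''_n:=2(\|\alpha\|_\infty+\|\gamma\|_\infty)\sin\frac{\pi}{2(n+1)},$$ it holds that $$\Gamma^n_\varepsilon(A)\subset\mathrm{Spec}_\varepsilon A\subset\Gamma^n_{\varepsilon+\varepsilon''_n}(A),\quad\varepsilon\ge0,\qquad\text{and}\qquad\gamma^n_\varepsilon(A)\subset\mathrm{spec}_\varepsilon A\subset\gamma^n_{\varepsilon+\varepsilon''_n}(A),\quad\varepsilon>0.$$
   Context: $E=\ell^2(\mathbb Z,X)$ has norm $(\sum_j\|x_j\|_X^2)^{1/2}$. Tridiagonal: $(Ax)_i=\alpha_{i-1}x_{i-1}+\beta_ix_i+\gamma_{i+1}x_{i+1}$ with bounded sequences $\alpha,\beta,\gamma$ in $L(X)$, i.e. matrix entries $a_{j+1,j}=\alpha_j$, $a_{j,j}=\beta_j$, $a_{j-1,j}=\gamma_j$, zeros elsewhere; $\|\alpha\|_\infty:=\sup_j\|\alpha_j\|_{L(X)}$, etc. The Banach space adjoint $A^*$ acts on $E^*=\ell^2(\mathbb Z,X^* )$ with matrix $[a_{j,i}^*]$ (so $(A-\lambda I)^*=A^*-\lambda I$). Lower norm: $\nu(B):=\inf_{\|x\|=1}\|Bx\|$. $E_{n,k}$ is the subspace of sequences (in $E$, or in $E^*$ for adjoints) supported in $\{k+1,\dots,k+n\}$. $$\mu_n(B):=\inf_{k\in\mathbb Z}\min\big(\nu(B|_{E_{n,k}}),\nu(B^*|_{E_{n,k}})\big),$$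 $\gamma^n_\varepsilon(A):=\{\lambda\in\mathbb C:\mu_n(A-\lambda I)<\varepsilon\}$ ($\varepsilon>0$), $\Gamma^n_\varepsilon(A):=\{\lambda\in\mathbb C:\mu_n(A-\lambda I)\le\varepsilon\}$ ($\varepsilon\ge0$). Pseudospectra: with $\|C^{-1}\|:=\infty$ if $C$ is not invertible and $1/\infty:=0$, $\mathrm{Spec}_\varepsilon B:=\{\lambda:1/\|(B-\lambda I)^{-1}\|\le\varepsilon\}$ for $\varepsilon>0$, $\mathrm{Spec}_0B:=\mathrm{Spec}\,B$ (the spectrum), and $\mathrm{spec}_\varepsilon B:=\{\lambda:1/\|(B-\lambda I)^{-1}\|<\varepsilon\}$ for $\varepsilon>0$. *)

(* Defs.v *)
From HB Require Import structures.
From mathcomp Require Import all_boot all_order all_algebra complex.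
From mathcomp Require Import all_classical all_reals all_analysis.
From mathcomp Require Import zify ring lra.

Set Implicit Arguments.
Unset Strict Implicit.
Unset Printing Implicit Defensive.

Import Order.TTheory GRing.Theory Num.Theory.
Import numFieldNormedType.Exports.

Local Open Scope classical_set_scope.
Local Open Scope ring_scope.
Local Open Scope complex_scope.

(* In a normed module over [R[i]] the library norm [`|v|] is an element of
   [R[i]] (real and nonnegative); [nrm v] is the same number as an element of
   [R]. *)
Definition nrm (R : realType) (V : normedModType R[i]) (v : V) : R :=
  complex.Re `|v|.

Section Nrm.
Variables (R : realType) (V : normedModType R[i]).
Implicit Types u v : V.

Lemma nrmE v : `|v| = (nrm v)%:C.
Proof. by rewrite /nrm RRe_real // normr_real. Qed.

Lemma nrm_ge0 v : 0 <= nrm v.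
Proof. by have := normr_ge0 v; rewrite nrmE lecR. Qed.

Lemma nrm0 : nrm (0 : V) = 0.
Proof. by rewrite /nrm normr0. Qed.

Lemma nrm0_eq0 v : nrm v = 0 -> v = 0.
Proof. by move=> h; apply/normr0_eq0; rewrite nrmE h. Qed.

Lemma ler_nrmD u v : nrm (u + v) <= nrm u + nrm v.
Proof. by rewrite -lecR rmorphD /= -!nrmE ler_normD. Qed.

Lemma ReN_ge0 (a : R[i]) : 0 <= complex.Re `|a|.
Proof. by have := normr_ge0 a; rewrite lecE => /andP[]. Qed.

Lemma ReNE (a : R[i]) : (complex.Re `|a|)%:C = `|a|.
Proof. by apply: RRe_real; exact: ger0_real. Qed.

Lemma nrmZ (a : R[i]) v : nrm (a *: v) = complex.Re `|a| * nrm v.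
Proof. by apply: (@complexI R); rewrite -nrmE normrZ nrmE rmorphM /= ReNE. Qed.

End Nrm.

Section BoundedOperators.
Variables (R : realType) (V W : normedModType R[i]).

Definition bounded_linear (f : V -> W) : Prop :=
  linear f /\ exists M : R, forall v, nrm (f v) <= M * nrm v.

Definition bounded_linear_pred : {pred V -> W} := fun f => `[< bounded_linear f >].

(* The space L(V, W), whose normed-module norm (instance below) is [opnorm]. *)
Record bop := Bop { bop_fun :> V -> W; _ : bop_fun \in bounded_linear_pred }.

HB.instance Definition _ := [isSub of bop for bop_fun].
HB.instance Definition _ := [Choice of bop by <:].

Lemma bounded_linear_submod : submod_closed bounded_linear_pred.
Proof.
split.
  apply/asboolP; split; first by move=> a u v /=; rewrite scaler0 addr0.
  by exists 0 => v; rewrite nrm0 mul0r.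
move=> a f g /asboolP[lf [M fM]] /asboolP[lg [N gN]]; apply/asboolP; split.
  move=> b u v; rewrite /= !fctE /= lf lg !scalerDr !scalerA (mulrC a).
  by rewrite addrACA.
exists (complex.Re `|a| * M + N) => v.
rewrite mulrDl (le_trans (ler_nrmD _ _))// lerD// nrmZ -mulrA.
by rewrite ler_wpM2l ?ReN_ge0.
Qed.

HB.instance Definition _ :=
  GRing.isSubmodClosed.Build R[i] (V -> W) bounded_linear_pred
    bounded_linear_submod.
HB.instance Definition _ := [SubChoice_isSubLmodule of bop by <:].

Lemma bopP (f : bop) : bounded_linear f.
Proof. by case: f => f fP; exact/asboolP. Qed.

Lemma bop_linear (f : bop) : linear f.
Proof. by case: (bopP f). Qed.

HB.instance Definition _ (f : bop) :=
  GRing.isLinear.Build R[i] V W *:%R f (bop_linear f).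

Lemma bop_ext (f g : bop) : f =1 g -> f = g.
Proof. by move=> fg; apply: val_inj; apply/funext. Qed.

Lemma bop_addE (f g : bop) v : (f + g) v = f v + g v. Proof. by []. Qed.
Lemma bop_oppE (f : bop) v : (- f) v = - f v. Proof. by []. Qed.
Lemma bop_scaleE (a : R[i]) (f : bop) v : (a *: f) v = a *: f v.
Proof. by []. Qed.

Definition opnorm (f : bop) : R := sup [set nrm (f v) | v in [set v | nrm v <= 1]].

Let opset_nonempty (f : bop) :
  [set nrm (f v) | v in [set v | nrm v <= 1]] !=set0.
Proof. by exists (nrm (f 0)); exists 0 => //=; rewrite nrm0. Qed.

Lemma opnorm_ub (f : bop) v : nrm v <= 1 -> nrm (f v) <= opnorm f.
Proof.
move=> v1; apply: ub_le_sup; last by exists v.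
have [_ [M fM]] := bopP f; exists (Num.max M 0) => _ [u u1 <-].
rewrite (le_trans (fM u))//.
have hM : M * nrm u <= Num.max M 0 * nrm u.
  by rewrite ler_wpM2r ?nrm_ge0// le_max lexx.
rewrite (le_trans hM)//.
by rewrite -[leRHS]mulr1 ler_wpM2l// le_max lexx orbT.
Qed.

Lemma opnorm_ge0 (f : bop) : 0 <= opnorm f.
Proof.
by rewrite (le_trans _ (@opnorm_ub f 0 _)) ?nrm_ge0 ?nrm0.
Qed.

Lemma opnormP (f : bop) v : nrm (f v) <= opnorm f * nrm v.
Proof.
have [v0|v0] := eqVneq (nrm v) 0.
  by rewrite (nrm0_eq0 v0) linear0 !nrm0 mulr0.
have v_gt0 : 0 < nrm v by rewrite lt_neqAle eq_sym v0 nrm_ge0.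
have Rev : complex.Re `|(nrm v)^-1%:C| = (nrm v)^-1.
  by rewrite ger0_norm// lecR invr_ge0 nrm_ge0.
have := @opnorm_ub f ((nrm v)^-1%:C *: v).
rewrite linearZ/= !nrmZ Rev mulVf// lexx => /(_ isT).
by rewrite mulrC ler_pdivrMr.
Qed.

Lemma opnorm_le (f : bop) M :
  0 <= M -> (forall v, nrm (f v) <= M * nrm v) -> opnorm f <= M.
Proof.
move=> M0 fM; apply: ge_sup; first exact: opset_nonempty.
move=> _ [v v1 <-]; rewrite (le_trans (fM v))//.
by rewrite -[leRHS]mulr1 ler_wpM2l.
Qed.

Lemma opnormD (f g : bop) : opnorm (f + g) <= opnorm f + opnorm g.
Proof.
apply: opnorm_le => [|v]; first by rewrite addr_ge0 ?opnorm_ge0.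
by rewrite mulrDl (le_trans (ler_nrmD _ _))// lerD ?opnormP.
Qed.

Lemma opnormZ_le (a : R[i]) (f : bop) :
  opnorm (a *: f) <= complex.Re `|a| * opnorm f.
Proof.
apply: opnorm_le => [|v]; first by rewrite mulr_ge0 ?ReN_ge0 ?opnorm_ge0.
rewrite (_ : (a *: f) v = a *: f v)// nrmZ -mulrA.
by rewrite ler_wpM2l ?ReN_ge0 ?opnormP.
Qed.

Lemma opnorm0_eq0 (f : bop) : opnorm f = 0 -> f = 0.
Proof.
move=> f0; apply: bop_ext => v; apply: nrm0_eq0; apply/eqP.
by rewrite eq_le nrm_ge0 andbT -(mul0r (nrm v)) -f0 opnormP.
Qed.

Lemma opnormZ (a : R[i]) (f : bop) :
  opnorm (a *: f) = complex.Re `|a| * opnorm f.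
Proof.
have [->|a0] := eqVneq a 0.
  apply/eqP; rewrite normr0 /= mul0r eq_le opnorm_ge0 andbT.
  by rewrite (le_trans (opnormZ_le _ _))// normr0 /= mul0r.
apply/eqP; rewrite eq_le opnormZ_le /=.
have := opnormZ_le a^-1 (a *: f); rewrite scalerA mulVf// scale1r.
have ReaK : complex.Re `|a| * complex.Re `|a^-1| = 1.
  apply: (@complexI R).
  by rewrite rmorphM /= !ReNE -normrM mulfV// normr1.
by move=> /(ler_wpM2l (ReN_ge0 a)); rewrite mulrA ReaK mul1r.
Qed.

Let opnormC (f : bop) : R[i] := (opnorm f)%:C.

Let opnormCD f g : opnormC (f + g) <= opnormC f + opnormC g.
Proof. by rewrite /opnormC -rmorphD /= lecR opnormD. Qed.

Let opnormCZ (a : R[i]) f : opnormC (a *: f) = `|a| * opnormC f.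
Proof.
by rewrite /opnormC opnormZ rmorphM /= ReNE.
Qed.

Let opnormC0_eq0 f : opnormC f = 0 -> f = 0.
Proof. by move=> /complexI /opnorm0_eq0. Qed.

HB.instance Definition _ :=
  Lmodule_isNormed.Build R[i] bop opnormCD opnormCZ opnormC0_eq0.

Lemma nrm_bopE (f : bop) : nrm f = opnorm f.
Proof. by []. Qed.

End BoundedOperators.

Notation "''L' ( V , W )" := (bop V W)
  (at level 8, format "''L' ( V ,  W )") : type_scope.
Notation "''L' ( V )" := (bop V V)
  (at level 8, format "''L' ( V )") : type_scope.

Section Dual.
Variable (R : realType).

(* The space X^* of bounded functionals; [R[i]^o] is the field R[i] viewed as
   a normed module over itself. *)
Definition dual (V : normedModType R[i]) : normedModType R[i] :=
  'L(V, R[i]^o).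

Lemma idop_subproof (V : normedModType R[i]) :
  (fun v => v) \in @bounded_linear_pred R V V.
Proof.
by apply/asboolP; split => //; exists 1 => v; rewrite mul1r.
Qed.

Definition idop (V : normedModType R[i]) : 'L(V) := Bop (idop_subproof V).

Lemma bop_comp_subproof (U V W : normedModType R[i]) (g : 'L(V, W))
    (f : 'L(U, V)) : g \o f \in @bounded_linear_pred R U W.
Proof.
apply/asboolP; split; first by move=> a u v /=; rewrite !linearP.
exists (opnorm g * opnorm f) => v /=.
rewrite (le_trans (opnormP _ _))// -mulrA.
by rewrite ler_wpM2l ?opnorm_ge0 ?opnormP.
Qed.

Definition bop_comp (U V W : normedModType R[i]) (g : 'L(V, W))
  (f : 'L(U, V)) : 'L(U, W) := Bop (bop_comp_subproof g f).

Lemma opnorm_comp (U V W : normedModType R[i]) (g : 'L(V, W)) (f : 'L(U, V)) :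
  opnorm (bop_comp g f) <= opnorm f * opnorm g.
Proof.
rewrite mulrC; apply: opnorm_le => [|v]; first by rewrite mulr_ge0 ?opnorm_ge0.
rewrite (le_trans (opnormP g (f v)))// -mulrA.
by rewrite ler_wpM2l ?opnorm_ge0 ?opnormP.
Qed.

Lemma bop_adj_subproof (V W : normedModType R[i]) (f : 'L(V, W)) :
  (fun y : dual W => bop_comp y f : dual V) \in
  @bounded_linear_pred R (dual W) (dual V).
Proof.
apply/asboolP; split; first by move=> a y z; exact: bop_ext.
by exists (opnorm f) => y; exact: opnorm_comp.
Qed.

(* The Banach space adjoint of [f]: precomposition with [f]. *)
Definition bop_adj (V W : normedModType R[i]) (f : 'L(V, W)) :
  'L(dual W, dual V) := Bop (bop_adj_subproof f).

Lemma opnorm_adj (V W : normedModType R[i]) (f : 'L(V, W)) :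
  opnorm (bop_adj f) <= opnorm f.
Proof.
by apply: opnorm_le => [|y]; [exact: opnorm_ge0|exact: opnorm_comp].
Qed.

End Dual.

(* The space l^2(Z, V), whose normed-module norm (instance below) is [l2norm]. *)
Section L2.
Variables (R : realType) (V : normedModType R[i]).
Implicit Types x y : int -> V.

Definition sqsum x : \bar R := \esum_(j in [set: int]) (nrm (x j) ^+ 2)%:E.

Definition l2_pred : {pred int -> V} := fun x => (sqsum x < +oo)%E.

Record l2 := L2 { l2_fun :> int -> V; _ : l2_fun \in l2_pred }.

HB.instance Definition _ := [isSub of l2 for l2_fun].
HB.instance Definition _ := [Choice of l2 by <:].

Lemma sqsum_ge0 x : (0 <= sqsum x)%E.
Proof. by apply: esum_ge0 => j _; rewrite lee_fin sqr_ge0. Qed.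

Lemma sqsum0 : sqsum 0 = 0%E.
Proof. by apply: esum1 => j _; rewrite nrm0 expr0n. Qed.

Let esumM_le (c : R) (a : int -> R) : 0 <= c -> (forall j, 0 <= a j) ->
  (\esum_(j in [set: int]) (c * a j)%:E
    <= c%:E * \esum_(j in [set: int]) (a j)%:E)%E.
Proof.
move=> c0 a0; apply: ge_ereal_sup => _ [X [Xfin XT] <-].
rewrite (_ : (\sum_(j \in X) (c * a j)%:E)%E =
             (c%:E * \sum_(j \in X) (a j)%:E)%E); last first.
  rewrite !fsbig_finite//= !sumEFin -EFinM mulr_sumr.
  by [].
rewrite lee_wpmul2l ?lee_fin//; apply: esum_ge; exists X => //.
Qed.

Lemma le_sqsum (c : R) x y : 0 <= c -> (forall j, nrm (x j) <= c * nrm (y j)) ->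
  (sqsum x <= (c ^+ 2)%:E * sqsum y)%E.
Proof.
move=> c0 xy; apply: (le_trans _ (esumM_le _ _)); rewrite ?sqr_ge0//; last first.
  by move=> j; rewrite sqr_ge0.
apply: le_esum => j _; rewrite lee_fin -exprMn.
by rewrite ler_pXn2r// ?nnegrE ?mulr_ge0 ?nrm_ge0.
Qed.

Lemma sqsumD_le (s t : R) x y : 0 < s -> 0 < t ->
  (sqsum (fun j => x j + y j)%R
    <= (1 + t / s)%R%:E * sqsum x + (1 + s / t)%R%:E * sqsum y)%E.
Proof.
move=> s0 t0.
have ts0 : 0 <= 1 + t / s by rewrite addr_ge0// divr_ge0 ?ltW.
have st0 : 0 <= 1 + s / t by rewrite addr_ge0// divr_ge0 ?ltW.
apply: le_trans (leeD (esumM_le ts0 _) (esumM_le st0 _)); last 2 first.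
- by move=> j; rewrite sqr_ge0.
- by move=> j; rewrite sqr_ge0.
rewrite -esumD; last 2 first.
- by move=> j _; rewrite lee_fin mulr_ge0 ?sqr_ge0.
- by move=> j _; rewrite lee_fin mulr_ge0 ?sqr_ge0.
apply: le_esum => j _; rewrite -EFinD lee_fin.
set a := nrm (x j); set b := nrm (y j).
have ab : nrm (x j + y j) ^+ 2 <= (a + b) ^+ 2.
  by rewrite ler_pXn2r// ?nnegrE ?addr_ge0 ?nrm_ge0// ler_nrmD.
rewrite (le_trans ab)// -subr_ge0.
have sN0 : s != 0 by rewrite gt_eqF.
have tN0 : t != 0 by rewrite gt_eqF.
rewrite (_ : _ - _ = (t * a - s * b) ^+ 2 / (s * t)); last by field; apply/andP.
by rewrite divr_ge0 ?sqr_ge0// mulr_ge0 ?ltW.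
Qed.

Lemma l2_predD x y : x \in l2_pred -> y \in l2_pred ->
  (fun j => x j + y j) \in l2_pred.
Proof.
rewrite /l2_pred !unfold_in => xoo yoo.
apply: (le_lt_trans (@sqsumD_le 1 1 x y _ _)) => //.
by apply: lte_add_pinfty; rewrite lte_mul_pinfty// lee_fin divr1 addr_ge0.
Qed.

Lemma l2_predM (c : R) x y : (forall j, nrm (x j) <= c * nrm (y j)) ->
  y \in l2_pred -> x \in l2_pred.
Proof.
move=> xy; rewrite /l2_pred !unfold_in => yoo.
apply: (le_lt_trans (@le_sqsum (Num.max c 0) x y _ _)).
- by rewrite le_max lexx orbT.
- move=> j; rewrite (le_trans (xy j))// ler_wpM2r ?nrm_ge0//.
  by rewrite le_max lexx.
- by rewrite lte_mul_pinfty// lee_fin sqr_ge0.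
Qed.

Lemma l2_submod : submod_closed l2_pred.
Proof.
split; first by rewrite /l2_pred !unfold_in sqsum0.
move=> a x y xl yl; apply: l2_predD => //.
by apply: (@l2_predM (complex.Re `|a|) _ x) => // j; rewrite nrmZ.
Qed.

HB.instance Definition _ :=
  GRing.isSubmodClosed.Build R[i] (int -> V) l2_pred l2_submod.
HB.instance Definition _ := [SubChoice_isSubLmodule of l2 by <:].

Lemma l2P (x : l2) : (x : int -> V) \in l2_pred.
Proof. by case: x. Qed.

Lemma l2_ext (x y : l2) : x =1 y -> x = y.
Proof. by move=> xy; apply: val_inj; apply/funext. Qed.

Lemma l2_addE (x y : l2) j : (x + y) j = x j + y j. Proof. by []. Qed.
Lemma l2_oppE (x : l2) j : (- x) j = - x j. Proof. by []. Qed.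
Lemma l2_scaleE (a : R[i]) (x : l2) j : (a *: x) j = a *: x j.
Proof. by []. Qed.

Definition l2norm (x : l2) : R := Num.sqrt (fine (sqsum x)).

Lemma sqsumE (x : l2) : sqsum x = (l2norm x ^+ 2)%:E.
Proof.
have xfin : sqsum x \is a fin_num.
  by rewrite ge0_fin_numE ?sqsum_ge0//; exact: (l2P x).
by rewrite /l2norm sqr_sqrtr ?fine_ge0 ?sqsum_ge0// fineK.
Qed.

Lemma l2norm_ge0 (x : l2) : 0 <= l2norm x. Proof. exact: sqrtr_ge0. Qed.

Lemma l2norm_le (x : l2) (M : R) :
  0 <= M -> (sqsum x <= (M ^+ 2)%:E)%E -> l2norm x <= M.
Proof.
by move=> M0; rewrite sqsumE lee_fin ler_pXn2r// nnegrE ?l2norm_ge0.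
Qed.

Lemma l2normM (x y : l2) (c : R) : 0 <= c ->
  (forall j, nrm (x j) <= c * nrm (y j)) -> l2norm x <= c * l2norm y.
Proof.
move=> c0 xy; apply: l2norm_le; first by rewrite mulr_ge0 ?l2norm_ge0.
by rewrite (le_trans (le_sqsum c0 xy))// sqsumE -EFinM exprMn.
Qed.

Lemma l2normD (x y : l2) : l2norm (x + y) <= l2norm x + l2norm y.
Proof.
apply/ler_addgt0Pr => e e0.
set s := l2norm x + e / 2; set t := l2norm y + e / 2.
have e20 : 0 < e / 2 by rewrite divr_gt0.
have s0 : 0 < s by rewrite ltr_wpDl ?l2norm_ge0.
have t0 : 0 < t by rewrite ltr_wpDl ?l2norm_ge0.
rewrite (_ : _ + e = s + t); last by rewrite /s /t addrACA -splitr.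
apply: l2norm_le; first by rewrite addr_ge0 ?ltW.
apply: (le_trans (@sqsumD_le s t x y s0 t0)).
rewrite !sqsumE -!EFinM -EFinD lee_fin.
have -> : (s + t) ^+ 2 = (1 + t / s) * s ^+ 2 + (1 + s / t) * t ^+ 2.
  by field; rewrite !gt_eqF.
apply: lerD; apply: ler_wpM2l.
- by rewrite addr_ge0// divr_ge0 ?ltW.
- by rewrite ler_pXn2r ?nnegrE ?l2norm_ge0 ?(ltW s0)// lerDl ltW.
- by rewrite addr_ge0// divr_ge0 ?ltW.
- by rewrite ler_pXn2r ?nnegrE ?l2norm_ge0 ?(ltW t0)// lerDl ltW.
Qed.

Lemma l2norm0_eq0 (x : l2) : l2norm x = 0 -> x = 0.
Proof.
move=> x0; apply: l2_ext => j; apply: nrm0_eq0; apply/eqP.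
suff : nrm (x j) ^+ 2 <= 0.
  by move=> h; rewrite -sqrf_eq0 eq_le h sqr_ge0.
have sx0 : sqsum x = 0%E by rewrite sqsumE x0 expr0n.
have nn i : (0 <= (nrm (x i) ^+ 2)%:E)%E by rewrite lee_fin sqr_ge0.
rewrite -lee_fin.
have -> : 0%:E = sqsum x by rewrite sx0.
rewrite /sqsum (esumID [set j])// setTI esum_set1//.
by rewrite leeDl// esum_ge0.
Qed.

Lemma l2normZ (a : R[i]) (x : l2) : l2norm (a *: x) = complex.Re `|a| * l2norm x.
Proof.
have le_Z b (y : l2) : l2norm (b *: y) <= complex.Re `|b| * l2norm y.
  by apply: l2normM => [|j]; rewrite ?ReN_ge0// nrmZ.
have [->|a0] := eqVneq a 0.
  apply/eqP; rewrite normr0 /= mul0r eq_le l2norm_ge0 andbT.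
  by rewrite (le_trans (le_Z _ _))// normr0 /= mul0r.
apply/eqP; rewrite eq_le le_Z /=.
have := le_Z a^-1 (a *: x); rewrite scalerA mulVf// scale1r.
have ReaK : complex.Re `|a| * complex.Re `|a^-1| = 1.
  apply: (@complexI R).
  by rewrite rmorphM /= !ReNE -normrM mulfV// normr1.
by move=> /(ler_wpM2l (ReN_ge0 a)); rewrite mulrA ReaK mul1r.
Qed.

Let l2normC (x : l2) : R[i] := (l2norm x)%:C.

Let l2normCD (x y : l2) : l2normC (x + y) <= l2normC x + l2normC y.
Proof. by rewrite /l2normC -rmorphD /= lecR l2normD. Qed.

Let l2normCZ (a : R[i]) (x : l2) : l2normC (a *: x) = `|a| * l2normC x.
Proof. by rewrite /l2normC l2normZ rmorphM /= ReNE. Qed.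

Let l2normC0_eq0 (x : l2) : l2normC x = 0 -> x = 0.
Proof. by move=> /complexI /l2norm0_eq0. Qed.

HB.instance Definition _ :=
  Lmodule_isNormed.Build R[i] l2 l2normCD l2normCZ l2normC0_eq0.

Lemma nrm_l2E (x : l2) : nrm x = l2norm x.
Proof. by []. Qed.

End L2.

Section SpectralNotions.
Variables (R : realType) (V : normedModType R[i]).

(* nu(B|_S) = inf {|B x| : x in S, |x| = 1}, which is +oo when S contains no
   unit vector. *)
Definition lower_norm (W : normedModType R[i]) (B : 'L(V, W)) (S : set V) : \bar R :=
  ereal_inf [set (nrm (B x))%:E | x in [set x | S x /\ nrm x = 1]].

Definition is_inverse (B C : 'L(V)) : Prop :=
  cancel B C /\ cancel C B.

(* The inverse is required to be bounded, being an element of L(V). *)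
Definition invertible (B : 'L(V)) : Prop := exists C, is_inverse B C.

(* The norm of B^-1, with the convention +oo when B is not invertible. *)
Definition inv_norm (B : 'L(V)) : \bar R :=
  match pselect (invertible B) with
  | left h => (nrm (projT1 (cid h)))%:E
  | right _ => +oo%E
  end.

Definition spectrum (B : 'L(V)) : set R[i] :=
  [set l | ~ invertible (B - l *: idop V)].

(* Closed (Spec_) and open (spec_) epsilon-pseudospectra. The library
   inverse on \bar R satisfies 0^-1 = +oo and (+oo)^-1 = 0. *)
Definition Spec_ (e : R) (B : 'L(V)) : set R[i] :=
  if e == 0 then spectrum B
  else [set l | ((inv_norm (B - l *: idop V)%R)^-1 <= e%:E)%E].

Definition spec_ (e : R) (B : 'L(V)) : set R[i] :=
  [set l | ((inv_norm (B - l *: idop V)%R)^-1 < e%:E)%E].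

End SpectralNotions.

Definition bounded_seq (R : realType) (V : normedModType R[i]) (a : int -> V) :
    Prop :=
  exists M : R, forall j, nrm (a j) <= M.

Definition sup_norm (R : realType) (V : normedModType R[i]) (a : int -> V) : R :=
  sup (range (fun j => nrm (a j))).

(* A tridiagonal bi-infinite matrix with bounded L(V)-valued diagonals, the
   indexing of the diagonals being that of [entry] below. *)
Record tridiag (R : realType) (V : normedModType R[i]) := Tridiag {
  alpha : int -> 'L(V);
  beta : int -> 'L(V);
  gamma : int -> 'L(V);
  alpha_bounded : bounded_seq alpha;
  beta_bounded : bounded_seq beta;
  gamma_bounded : bounded_seq gamma }.

Section Tridiagonal.
Variables (R : realType) (V : normedModType R[i]).
Implicit Types A : tridiag V.

Definition entry A (i j : int) : 'L(V) :=
  if i == j + 1 then alpha A j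
  else if i == j then beta A j
  else if i == j - 1 then gamma A j
  else 0.

Definition tridiag_fun A (x : int -> V) (i : int) : V :=
  alpha A (i - 1) (x (i - 1)) + beta A i (x i) + gamma A (i + 1) (x (i + 1)).

Lemma tridiag_fun_entry A (x : int -> V) (i : int) :
  tridiag_fun A x i = entry A i (i - 1) (x (i - 1)) + entry A i i (x i)
                      + entry A i (i + 1) (x (i + 1)).
Proof.
rewrite /tridiag_fun /entry subrK addrK !eqxx.
have -> : (i == i + 1) = false by lia.
by have -> : (i == i + 1 + 1) = false by lia.
Qed.

Lemma sqsum_shift (c : int) (x : int -> V) :
  sqsum (fun i => x (i + c)) = sqsum x.
Proof.
rewrite /sqsum [RHS](@reindex_esum R int int [set: int] [set: int] (fun i => i + c))//.
split => //.
- by move=> i j _ _ /addIr.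
- by move=> j _; exists (j - c) => //; rewrite subrK.
Qed.

Lemma l2_shift (c : int) (x : int -> V) :
  x \in @l2_pred R V -> (fun i => x (i + c)) \in @l2_pred R V.
Proof. by rewrite /l2_pred !unfold_in sqsum_shift. Qed.

Lemma l2norm_shift (c : int) (x y : l2 V) :
  (forall i, y i = x (i + c)) -> l2norm y = l2norm x.
Proof.
move=> yx; rewrite /l2norm -(sqsum_shift c x).
by congr (Num.sqrt (fine (sqsum _))); apply/funext => i; rewrite -yx.
Qed.

Lemma l2_diag (a : int -> 'L(V)) (x : l2 V) : bounded_seq a ->
  (fun j => a j (x j)) \in @l2_pred R V.
Proof.
move=> [M aM]; apply: (@l2_predM R V M _ x _ (l2P x)) => j.
by rewrite (le_trans (opnormP _ _))// ler_wpM2r ?nrm_ge0//; exact: aM.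
Qed.

Let diag_shift (a : int -> 'L(V)) (x : l2 V) (c : int) (ha : bounded_seq a) :
    l2 V :=
  L2 (l2_shift c (l2_diag x ha)).

Lemma sup_norm_ub (a : int -> 'L(V)) (j : int) :
  bounded_seq a -> nrm (a j) <= sup_norm a.
Proof.
move=> [M aM]; apply: ub_le_sup; last by exists j.
by exists M => _ [i _ <-].
Qed.

Lemma sup_norm_ge0 (a : int -> 'L(V)) : bounded_seq a -> 0 <= sup_norm a.
Proof. by move=> ha; exact: le_trans (nrm_ge0 _) (sup_norm_ub 0 ha). Qed.

Lemma l2norm_diag_shift (a : int -> 'L(V)) (x : l2 V) (c : int)
    (ha : bounded_seq a) :
  l2norm (diag_shift x c ha) <= sup_norm a * l2norm x.
Proof.
rewrite (@l2norm_shift c (L2 (l2_diag x ha)))//.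
apply: l2normM => [|j]; first exact: sup_norm_ge0.
rewrite (le_trans (opnormP _ _))// ler_wpM2r ?nrm_ge0//.
exact: sup_norm_ub.
Qed.

Lemma tridiag_fun_l2 A (x : l2 V) : tridiag_fun A x \in @l2_pred R V.
Proof.
apply: l2_predD; first apply: l2_predD.
- exact: (l2_shift (- 1) (l2_diag x (alpha_bounded A))).
- exact: (l2_diag x (beta_bounded A)).
- exact: (l2_shift 1 (l2_diag x (gamma_bounded A))).
Qed.

Lemma tridiag_op_subproof A :
  (fun x => L2 (tridiag_fun_l2 A x)) \in @bounded_linear_pred R (l2 V) (l2 V).
Proof.
apply/asboolP; split.
  move=> a x y; apply: l2_ext => i.
  rewrite -[LHS]/(tridiag_fun A (a *: x + y : l2 V) i).
  rewrite -[RHS]/(a *: tridiag_fun A x i + tridiag_fun A y i) /tridiag_fun.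
  have E j : (a *: x + y : l2 V) j = a *: x j + y j by [].
  rewrite !E !linearP !scalerDr.
  by rewrite [RHS]addrACA; congr (_ + _); rewrite addrACA.
exists (sup_norm (alpha A) + sup_norm (beta A) + sup_norm (gamma A)) => x.
rewrite !nrm_l2E.
have -> : L2 (tridiag_fun_l2 A x) =
    diag_shift x (- 1) (alpha_bounded A) + diag_shift x 0 (beta_bounded A)
    + diag_shift x 1 (gamma_bounded A).
  apply: l2_ext => i.
  by rewrite -[RHS]/(alpha A (i - 1) (x (i - 1)) + beta A (i + 0) (x (i + 0))
                     + gamma A (i + 1) (x (i + 1))) !addr0.
rewrite !mulrDl; apply: (le_trans (l2normD _ _)).
apply: lerD; last exact: l2norm_diag_shift.
apply: (le_trans (l2normD _ _)).
by apply: lerD; exact: l2norm_diag_shift.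
Qed.

Definition tridiag_op A : 'L(l2 V) := Bop (tridiag_op_subproof A).

Lemma tridiag_opE A (x : l2 V) (i : int) :
  tridiag_op A x i
  = alpha A (i - 1) (x (i - 1)) + beta A i (x i) + gamma A (i + 1) (x (i + 1)).
Proof. by []. Qed.

End Tridiagonal.

Section Adjoint.
Variables (R : realType) (V : normedModType R[i]).
Implicit Types A : tridiag V.

Lemma bounded_seq_adj (a : int -> 'L(V)) (c : int) :
  bounded_seq a -> bounded_seq (fun j => bop_adj (a (j + c))).
Proof.
move=> [M aM]; exists M => j; apply: le_trans (aM (j + c)).
exact: opnorm_adj.
Qed.

(* The matrix [a_{j,i}^*] of the adjoint; see [entry_adj]. *)
Definition tridiag_adj A : tridiag (dual V) :=
  Tridiag (bounded_seq_adj 1 (gamma_bounded A))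
          (bounded_seq_adj 0 (beta_bounded A))
          (bounded_seq_adj (- 1) (alpha_bounded A)).

Lemma entry_adj A (i j : int) : entry (tridiag_adj A) i j = bop_adj (entry A j i).
Proof.
have adj0 : bop_adj (0 : 'L(V)) = 0.
  by apply: bop_ext => y; apply: bop_ext => v; exact: (linear0 y).
rewrite /entry /=; case: (eqVneq i (j + 1)) => [->|ij1].
  rewrite addrK eqxx.
  have -> : (j == j + 1 + 1) = false by lia.
  by have -> : (j == j + 1) = false by lia.
case: (eqVneq i j) => [<-|ij].
  rewrite addr0.
  by have -> : (i == i + 1) = false by lia.
case: (eqVneq i (j - 1)) => [->|ij2]; first by rewrite subrK eqxx.
have -> : (j == i + 1) = false by lia.
by have -> : (j == i - 1) = false by lia.
Qed.

Lemma bounded_seq_sub_scalar (a : int -> 'L(V)) (l : R[i]) :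
  bounded_seq a -> bounded_seq (fun j => a j - l *: idop V).
Proof.
move=> [M aM]; exists (M + nrm (- (l *: idop V))) => j.
by rewrite (le_trans (ler_nrmD _ _))// lerD.
Qed.

(* The matrix of A - l I. *)
Definition tridiag_sub A (l : R[i]) : tridiag V :=
  Tridiag (alpha_bounded A) (bounded_seq_sub_scalar l (beta_bounded A))
          (gamma_bounded A).

Lemma bop_adj_sub_scalar (f : 'L(V)) (l : R[i]) (y : dual V) :
  bop_adj (f - l *: idop V) y = (bop_adj f - l *: idop (dual V)) y.
Proof.
rewrite [RHS]bop_addE bop_oppE bop_scaleE.
apply: bop_ext => v; transitivity (y (f v) - l *: y v); last by [].
by rewrite -[LHS]/(y (f v - l *: v)) linearB linearZ.
Qed.

Lemma tridiag_op_sub A l :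
  tridiag_op (tridiag_sub A l) = tridiag_op A - l *: idop (l2 V).
Proof.
apply: bop_ext => x; apply: l2_ext => i.
rewrite -[RHS]/(tridiag_fun A x i - l *: x i).
rewrite -[LHS]/(tridiag_fun (tridiag_sub A l) x i) /tridiag_fun.
rewrite -[beta (tridiag_sub A l) i (x i)]/(beta A i (x i) - l *: x i).
by rewrite -!addrA [- _ + _]addrC.
Qed.

End Adjoint.

Lemma tridiag_adj_sub (R : realType) (V : normedModType R[i]) (A : tridiag V)
    (l : R[i]) :
  tridiag_op (tridiag_adj (tridiag_sub A l))
  = tridiag_op (tridiag_adj A) - l *: idop (l2 (dual V)).
Proof.
rewrite -tridiag_op_sub; apply: bop_ext => y; apply: l2_ext => i.
rewrite !tridiag_opE; congr (_ + _); congr (_ + _).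
exact: bop_adj_sub_scalar.
Qed.

Section Truncations.
Variables (R : realType) (V : normedModType R[i]).

(* E_{n,k}: sequences supported in {k+1, ..., k+n}. *)
Definition supported_in (n : nat) (k : int) : set (l2 V) :=
  [set x | forall j, ~~ (k + 1 <= j <= k + n%:Z) -> x j = 0].

End Truncations.

Section InclusionSets.
Variables (R : realType) (V : normedModType R[i]).
Implicit Types A : tridiag V.

(* mu_n of the operator with matrix A. *)
Definition mu (n : nat) A : \bar R :=
  ereal_inf (range (fun k : int =>
    mine (lower_norm (tridiag_op A) (supported_in n k))
         (lower_norm (tridiag_op (tridiag_adj A)) (supported_in n k)))).

Definition gamma_set (n : nat) (e : R) A : set R[i] :=
  [set l | (mu n (tridiag_sub A l) < e%:E)%E].

Definition Gamma_set (n : nat) (e : R) A : set R[i] :=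
  [set l | (mu n (tridiag_sub A l) <= e%:E)%E].

(* epsilon''_n *)
Definition eps2 (n : nat) A : R :=
  2 * (sup_norm (alpha A) + sup_norm (gamma A)) * sin (pi / (2 * n.+1%:R)).

End InclusionSets.

(* Main.v *)
(* For B = A - lambda I, the lower bounds 1/|B^-1| and the truncated bound mu_n B
   are compared with nu(B) and nu(B^* ).

   Left inclusions: if B is invertible then |x| <= |B^-1| |B x| and, since
   E^* = l^2(Z, X^* ) isometrically, |y| <= |B^-1| |B^* y|.

   Right inclusions: let w_j = sin (j pi / (n + 1)) on {0, ..., n + 1} and 0
   elsewhere, and let W_k x = (w_(j - k) x_j)_j, which lies in E_(n,k). The
   commutator of B and W_k only involves differences w_(j + 1) - w_j, and
   sum_j (w_(j + 1) - w_j)^2 = (2 sin (pi / (2 (n + 1))))^2 sum_j w_j^2 as w is the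
   ground state of the discrete Dirichlet Laplacian. Summing |B W_k x|^2 over k
   shows that a bound m |y| <= |B y| on every E_(n,k) gives
   (m - eps''_n) |x| <= |B x| on E, and likewise for B^*. If both B and B^* are
   bounded below, B has closed range, and dense range by Hahn-Banach, hence is
   invertible. *)

Require Import Defs.
From mathcomp Require Import all_boot all_order all_algebra complex.
From mathcomp Require Import all_classical all_reals all_analysis.
From mathcomp Require Import finmap zify ring lra.

Import Order.TTheory GRing.Theory Num.Theory.
Import numFieldNormedType.Exports.

Local Open Scope classical_set_scope.
Local Open Scope ring_scope.
Local Open Scope complex_scope.

Set Implicit Arguments.
Unset Strict Implicit.

(** * The Hahn-Banach theorem, from minimal sublinear functionals *)

Section HahnBanach.
Variables (R : realType) (V : lmodType R[i]).
Implicit Types (p q f : V -> R) (u v z : V).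

(** Only real scalars enter: Hahn-Banach is run over [R], and [complex_functional] makes the real
    functional complex afterwards. *)
Definition sublinear q : Prop :=
  (forall u v, q (u + v) <= q u + q v) /\
  (forall (t : R) v, 0 < t -> q (t%:C *: v) <= t * q v).

Lemma sublinear0 q : sublinear q -> q 0 = 0.
Proof.
move=> [_ qZ].
have := qZ 2^-1 0 ltac:(by rewrite invr_gt0); have := qZ 2 0 ltac:(by []).
by rewrite !scaler0; lra.
Qed.

Lemma sublinearZ q (t : R) v : sublinear q -> 0 < t -> q (t%:C *: v) = t * q v.
Proof.
move=> [qD qZ] t0; apply/eqP; rewrite eq_le qZ//=.
have tV0 : 0 < t^-1 by rewrite invr_gt0.
have := qZ t^-1 (t%:C *: v) tV0.
rewrite scalerA -rmorphM mulVf ?gt_eqF// scale1r => /(ler_wpM2l (ltW t0)).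
by rewrite mulrA mulfV ?gt_eqF// mul1r.
Qed.

Lemma sublinearN q v : sublinear q -> - q (- v) <= q v.
Proof.
by move=> q_sub; have := q_sub.1 v (- v); rewrite subrr (sublinear0 q_sub); lra.
Qed.

(* The largest sublinear functional below [q] that is linear along [z]. *)
Definition linearize q z v : R :=
  inf [set q (v + t%:C *: z) - t * q z | t in [set t | 0 <= t]].

Lemma linearize_le q z v (t : R) : sublinear q -> 0 <= t ->
  linearize q z v <= q (v + t%:C *: z) - t * q z.
Proof.
move=> q_sub t0; apply: ge_inf; last by exists t.
(* The infimum is finite: [s * q z = q (s z) <= q (v + s z) + q (- v)]. *)
exists (- q (- v)) => _ [s /= s0 <-].
have [->|sN0] := eqVneq s 0.
  by rewrite mul0r subr0 scale0r addr0; exact: sublinearN.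
have s_gt0 : 0 < s by rewrite lt_neqAle eq_sym sN0.
rewrite -(sublinearZ z q_sub s_gt0).
have := q_sub.1 (v + s%:C *: z) (- v).
by rewrite addrAC subrr add0r; lra.
Qed.

Lemma le_linearize q z v (m : R) :
  (forall t : R, 0 <= t -> m <= q (v + t%:C *: z) - t * q z) ->
  m <= linearize q z v.
Proof.
move=> h; apply: lb_le_inf; first by eexists; exists 0 => /=.
by move=> _ [t t0 <-]; exact: h.
Qed.

Lemma linearize_le_self q z v : sublinear q -> linearize q z v <= q v.
Proof.
move=> q_sub; have := linearize_le z v q_sub (lexx 0).
by rewrite mul0r subr0 scale0r addr0.
Qed.

Lemma linearizeN q z : sublinear q -> linearize q z (- z) <= - q z.
Proof.
move=> q_sub; have := linearize_le z (- z) q_sub ler01.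
by rewrite scale1r addNr (sublinear0 q_sub) mul1r sub0r.
Qed.

(** A shift [s] for [u] and a shift [t] for [v] add up to a shift [s + t] for [u + v]; a shift [t]
    for [v] becomes [s * t] for [s v]. *)
Lemma sublinear_linearize q z : sublinear q -> sublinear (linearize q z).
Proof.
move=> q_sub; split => [u v|s v s0].
  suff H (t : R) : 0 <= t ->
      linearize q z (u + v) - (q (v + t%:C *: z) - t * q z) <= linearize q z u.
    rewrite -lerBlDl; apply: le_linearize => t t0.
    by have := H t t0; lra.
  move=> t0; apply: le_linearize => s s0.
  have := linearize_le z (u + v) q_sub (addr_ge0 s0 t0).
  rewrite rmorphD /= scalerDl addrACA => h.
  have := q_sub.1 (u + s%:C *: z) (v + t%:C *: z).
  by lra.
suff : s^-1 * linearize q z (s%:C *: v) <= linearize q z v.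
  by rewrite mulrC ler_pdivrMr// mulrC.
apply: le_linearize => t t0.
rewrite mulrC ler_pdivrMr//.
have st0 : 0 <= s * t by rewrite mulr_ge0// ltW.
apply: (le_trans (linearize_le z _ q_sub st0)).
by rewrite rmorphM -scalerA -scalerDr (sublinearZ _ q_sub s0); lra.
Qed.

(** Zorn's lemma for the reversed pointwise order. A nonempty chain is bounded by its pointwise
    infimum, which is finite because every [q <= p] satisfies [q v >= - p (- v)]. *)
Lemma minimal_sublinear p : sublinear p ->
  exists q, [/\ sublinear q, forall v, q v <= p v &
    forall r, sublinear r -> (forall v, r v <= q v) -> forall v, q v <= r v].
Proof.
move=> p_sub.
pose T := {q : V -> R | sublinear q /\ forall v, q v <= p v}.
have p0 : sublinear p /\ forall v, p v <= p v by split.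
pose below (q r : T) := `[< forall v, sval r v <= sval q v >].
have [|||[q [q_sub qp]] qmin] := @ZL_preorder T (exist _ p p0) below.
- by move=> q; apply/asboolP.
- move=> q r s /asboolP rq /asboolP qs; apply/asboolP => v.
  exact: le_trans (qs v) (rq v).
- move=> C Ctot; have [[q0 Cq0]|C0] := pselect (exists a : T, C a); last first.
    by exists (exist _ p p0) => q Cq; case: C0; exists q.
  pose Q v := inf [set sval a v | a in C].
  have Qle (q : T) v : C q -> Q v <= sval q v.
    move=> Cq; apply: ge_inf; last by exists q.
    exists (- p (- v)) => _ [r Cr <-].
    apply: le_trans (sublinearN v (svalP r).1).
    by rewrite lerN2 (svalP r).2.
  have leQ m v : (forall a : T, C a -> m <= sval a v) -> m <= Q v.
    move=> h; apply: lb_le_inf; first by exists (sval q0 v); exists q0.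
    by move=> _ [q Cq <-]; exact: h.
  have Qsub : sublinear Q.
    split => [u v|t v t0].
      suff H (q : T) : C q -> Q (u + v) - sval q v <= Q u.
        by rewrite -lerBlDl; apply: leQ => q /H; lra.
      move=> Cq; apply: leQ => r Cr.
      (* Of two members of the chain, the smaller one serves for both [u] and [v]. *)
      have [/asboolP|/asboolP] := Ctot _ _ Cq Cr => [rq|qr].
        have := Qle r (u + v) Cr; have := (svalP r).1.1 u v; have := rq v.
        by lra.
      have := Qle q (u + v) Cq; have := (svalP q).1.1 u v; have := qr u.
      by lra.
    rewrite mulrC -ler_pdivrMr//; apply: leQ => q Cq.
    rewrite ler_pdivrMr// (le_trans (Qle q _ Cq))//.
    by rewrite mulrC ((svalP q).1.2).
  have Qp v : Q v <= p v by exact: le_trans (Qle q0 v Cq0) ((svalP q0).2 v).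
  by exists (exist _ Q (conj Qsub Qp)) => q Cq; apply/asboolP => v; exact: Qle.
exists q; split => // r r_sub rq v.
have rp u : r u <= p u by exact: le_trans (rq u) (qp u).
have /asboolP := qmin (exist _ r (conj r_sub rp)) ltac:(by apply/asboolP).
exact.
Qed.

(** Linearizing along [z] before minimizing forces [f (- z) <= - p z]. By minimality [f] lies below
    all its own linearizations, so [f (- v) <= - f v] for every [v]; an odd sublinear functional is
    linear. *)
Lemma hahn_banach p z : sublinear p -> exists f,
  [/\ forall u v, f (u + v) = f u + f v,
      forall (t : R) v, f (t%:C *: v) = t * f v,
      forall v, f v <= p v & p z <= f z].
Proof.
move=> p_sub.
have [f [f_sub fp fmin]] := minimal_sublinear (sublinear_linearize z p_sub).
have fN v : f (- v) = - f v.
  apply/eqP; rewrite eq_le; have := sublinearN v f_sub => h.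
  have := fmin _ (sublinear_linearize v f_sub)
            (fun u => linearize_le_self v u f_sub) (- v).
  by have := linearizeN v f_sub; lra.
exists f; split.
- move=> u v; apply/eqP; rewrite eq_le f_sub.1/=.
  by have := f_sub.1 (- u) (- v); rewrite -opprD !fN; lra.
- move=> t v; case: (ltgtP t 0) => [t0|t0|->].
  + have := sublinearZ v f_sub (t := - t) ltac:(by rewrite oppr_gt0).
    by rewrite rmorphN /= scaleNr fN; lra.
  + exact: sublinearZ.
  + by rewrite scale0r (sublinear0 f_sub) mul0r.
- by move=> v; exact: le_trans (fp v) (linearize_le_self z v p_sub).
- by have := fp (- z); have := linearizeN z p_sub; rewrite fN; lra.
Qed.

End HahnBanach.

(** * Unordered sums and square-summable sequences *)

Section ErealSums.
Variable R : realType.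

Lemma esum_support (T : choiceType) (a : T -> R) (s : seq T) :
  uniq s -> (forall j, 0 <= a j) -> (forall j, j \notin s -> a j = 0) ->
  \esum_(j in [set: T]) (a j)%:E = (\sum_(j <- s) a j)%:E.
Proof.
move=> s_uniq a0 as0; rewrite -sumEFin.
have <- : \esum_(j in [set` s]) (a j)%:E = \esum_(j in [set: T]) (a j)%:E.
  rewrite esum_mkcond; apply: eq_esum => j _; rewrite mem_setE.
  by case: ifPn => // /as0 ->.
rewrite esum_fset -?fsbig_seq//.
by move=> j _; rewrite lee_fin.
Qed.

Lemma esumZl (T : choiceType) (c : R) (a : T -> R) :
  0 <= c -> (forall j, 0 <= a j) ->
  (\esum_(j in [set: T]) (c * a j)%:E = c%:E * \esum_(j in [set: T]) (a j)%:E)%E.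
Proof.
move=> c0 a0.
have le_Z (d : R) (b : T -> R) : 0 <= d -> (forall j, 0 <= b j) ->
    (\esum_(j in [set: T]) (d * b j)%:E <= d%:E * \esum_(j in [set: T]) (b j)%:E)%E.
  move=> d0 b0; apply: ge_ereal_sup => _ [X [Xfin XT] <-].
  rewrite (_ : (\sum_(j \in X) (d * b j)%:E)%E =
               (d%:E * \sum_(j \in X) (b j)%:E)%E).
    by rewrite lee_wpmul2l ?lee_fin//; apply: esum_ge; exists X.
  by rewrite !fsbig_finite//= !sumEFin -EFinM mulr_sumr.
apply/eqP; rewrite eq_le le_Z//=.
have [->|cN0] := eqVneq c 0.
  by rewrite mul0e esum_ge0// => j _; rewrite mul0r.
have := le_Z c^-1 (fun j => c * a j)
  ltac:(by rewrite invr_ge0) ltac:(by move=> j; rewrite mulr_ge0).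
rewrite (eq_esum (b := fun j => (a j)%:E)) => [|j _]; last by rewrite mulKf.
move=> /(lee_wpmul2l (_ : (0 <= c%:E)%E)); rewrite lee_fin => /(_ c0).
by rewrite muleA -EFinM mulfV// mul1e.
Qed.

Lemma exchange_esum (S T : choiceType) (a : S -> T -> \bar R) :
  (forall i j, (0 <= a i j)%E) ->
  \esum_(i in [set: S]) \esum_(j in [set: T]) a i j =
  \esum_(j in [set: T]) \esum_(i in [set: S]) a i j.
Proof.
move=> a0; rewrite !esum_esum//.
rewrite (@reindex_esum _ _ _ ([set: T] `*`` (fun=> [set: S])) _
  (fun k => (k.2, k.1)))//.
split => //.
- by move=> [i j] [i' j'] _ _ [-> ->].
- by move=> [i j] _; exists (j, i).
Qed.

(** For fixed [i] the map [k |-> i - k] permutes the integers, so a sum over all window positions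
    [k] does not depend on [i]. *)
Lemma esum_convolution (c : R) (a : int -> R) (N : nat) (i : int) : 0 <= c ->
  (forall j, 0 <= a j) -> (forall j, ~~ (0 <= j < N%:Z) -> a j = 0) ->
  \esum_(k in [set: int]) (c * a (i - k))%:E = (c * \sum_(m < N) a m%:Z)%:E.
Proof.
move=> c0 a0 aN; transitivity (\esum_(k in [set: int]) (c * a k)%:E).
  rewrite [RHS](@reindex_esum _ _ _ [set: int] _ (fun k => i - k))//.
  split => //; first by move=> k l _ _ /addrI /oppr_inj.
  by move=> k _; exists (i - k) => //; rewrite opprB addrC subrK.
rewrite (@esum_support _ _ (map Posz (index_iota 0 N))).
- by rewrite big_map -mulr_sumr big_mkord.
- by rewrite map_inj_uniq ?iota_uniq// => k l [].
- by move=> j; rewrite mulr_ge0.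
- move=> j jN; rewrite aN ?mulr0//; apply: contra jN => /andP[j0 jN].
  by apply/mapP; exists `|j|%N; [rewrite mem_index_iota; lia|lia].
Qed.

End ErealSums.

(** * Finite sums and truncations in l^2(Z, V) *)

Section SquareSummable.
Variables (R : realType) (V : normedModType R[i]).
Implicit Types (x : int -> V) (s : seq int) (v : V).

Lemma nrmN v : nrm (- v) = nrm v. Proof. by rewrite /nrm normrN. Qed.

Lemma nrm_distC (u v : V) : nrm (u - v) = nrm (v - u).
Proof. by rewrite -opprB nrmN. Qed.

Lemma ler_nrmB (u v : V) : nrm u - nrm v <= nrm (u - v).
Proof. by rewrite lerBlDr -{1}[u](subrK v) ler_nrmD. Qed.

Lemma nrmZr (t : R) v : nrm (t%:C *: v) = `|t| * nrm v.
Proof. by rewrite nrmZ normc_def /= expr0n /= addr0 sqrtr_sqr. Qed.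

Lemma seq_le_sqsum x s : uniq s ->
  ((\sum_(j <- s) nrm (x j) ^+ 2)%:E <= sqsum x)%E.
Proof.
move=> s_uniq; apply: esum_ge; exists [set` s]; first by split; [exact: finite_seq|].
by rewrite -fsbig_seq//= sumEFin.
Qed.

Lemma sqsum_le x (M : R) :
  (forall s, uniq s -> \sum_(j <- s) nrm (x j) ^+ 2 <= M) ->
  (sqsum x <= M%:E)%E.
Proof.
move=> h; apply: ge_ereal_sup => _ [S [Sfin _] <-].
by rewrite fsbig_finite//= sumEFin lee_fin h// fset_uniq.
Qed.

Lemma sqsum_support x s : uniq s -> (forall j, j \notin s -> x j = 0) ->
  sqsum x = (\sum_(j <- s) nrm (x j) ^+ 2)%:E.
Proof.
move=> s_uniq xs; apply: esum_support => // j; first exact: sqr_ge0.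
by move=> /xs ->; rewrite nrm0 expr0n.
Qed.

Lemma trunc_subproof s x :
  (fun j => if j \in s then x j else 0) \in @l2_pred R V.
Proof.
rewrite /l2_pred unfold_in (@sqsum_support _ (undup s)) ?undup_uniq ?ltry//.
by move=> j; rewrite mem_undup => /negbTE ->.
Qed.

Definition trunc s x : l2 V := L2 (trunc_subproof s x).

Definition single (j : int) v : l2 V := trunc [:: j] (fun=> v).

Lemma truncE s x j : trunc s x j = if j \in s then x j else 0.
Proof. by []. Qed.

Lemma singleE i v j : single i v j = if j == i then v else 0.
Proof. by rewrite truncE inE. Qed.

Lemma l2norm_sqr_le (x : l2 V) (M : R) :
  (forall s, uniq s -> \sum_(j <- s) nrm (x j) ^+ 2 <= M) ->
  l2norm x ^+ 2 <= M.
Proof. by move=> /sqsum_le; rewrite sqsumE lee_fin. Qed.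

Lemma seq_le_l2norm (x : l2 V) s : uniq s ->
  \sum_(j <- s) nrm (x j) ^+ 2 <= l2norm x ^+ 2.
Proof. by move=> /(seq_le_sqsum x); rewrite sqsumE lee_fin. Qed.

Lemma nrm_le_l2norm (x : l2 V) j : nrm (x j) <= l2norm x.
Proof.
rewrite -(@ler_pXn2r _ 2) ?nnegrE ?nrm_ge0 ?l2norm_ge0//.
by have := @seq_le_l2norm x [:: j] isT; rewrite big_seq1.
Qed.

Lemma l2norm_trunc s x : uniq s ->
  l2norm (trunc s x) ^+ 2 = \sum_(j <- s) nrm (x j) ^+ 2.
Proof.
move=> s_uniq; apply: (@EFin_inj R).
rewrite -sqsumE (sqsum_support s_uniq) => [|j /negbTE js]; last first.
  by rewrite truncE js.
congr EFin; rewrite big_seq_cond [RHS]big_seq_cond.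
by apply: eq_bigr => j /andP[js _]; rewrite truncE js.
Qed.

Lemma l2norm_single j v : l2norm (single j v) = nrm v.
Proof.
apply/eqP; rewrite -(@eqrXn2 _ 2) ?nrm_ge0 ?l2norm_ge0//.
by rewrite l2norm_trunc// big_seq1.
Qed.

Lemma trunc_sum s x : uniq s -> trunc s x = \sum_(j <- s) single j (x j).
Proof.
elim: s => [_|j s IHs /= /andP[js s_uniq]].
  by rewrite big_nil; apply: l2_ext.
rewrite big_cons -IHs//; apply: l2_ext => i.
rewrite l2_addE singleE !truncE inE.
by have [->|] := eqVneq i j; rewrite ?(negbTE js) ?addr0 ?add0r.
Qed.

(** The squared norm is a supremum of finite sums: some [s] captures all of it but [e ^+ 2], and no
    finite sum over indices outside [s] exceeds what is left. *)
Lemma trunc_dense (x : l2 V) (e : R) : 0 < e ->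
  exists2 s, uniq s & l2norm (x - trunc s x) <= e.
Proof.
move=> e0; have [s [s_uniq hs]] : exists s, uniq s /\
    l2norm x ^+ 2 - e ^+ 2 <= \sum_(j <- s) nrm (x j) ^+ 2.
  apply: contrapT => hN.
  suff : l2norm x ^+ 2 <= l2norm x ^+ 2 - e ^+ 2.
    by have := exprn_gt0 2 e0; lra.
  apply: l2norm_sqr_le => s s_uniq; rewrite leNgt; apply/negP => /ltW h.
  by apply: hN; exists s.
exists s => //; apply: l2norm_le; first exact: ltW.
apply: sqsum_le => r r_uniq.
have h : \sum_(j <- s) nrm (x j) ^+ 2 +
    \sum_(j <- r | j \notin s) nrm (x j) ^+ 2 <= l2norm x ^+ 2.
  rewrite -[X in _ + X <= _]big_filter -big_cat; apply: seq_le_l2norm.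
  rewrite cat_uniq s_uniq filter_uniq// andbT /= -all_predC.
  by apply/allP => j /=; rewrite mem_filter => /andP[].
rewrite (_ : \sum_(j <- r) _ = \sum_(j <- r | j \notin s) nrm (x j) ^+ 2).
  by rewrite -(lerD2l (l2norm x ^+ 2 - e ^+ 2)); lra.
rewrite [RHS]big_mkcond; apply: eq_bigr => j _.
rewrite l2_addE l2_oppE truncE.
by case: ifP => _; rewrite ?subrr ?subr0// nrm0 expr0n.
Qed.

End SquareSummable.

(** * Completeness of l^2(Z, V) *)

Section Completeness.
Variable R : realType.

Definition nrm_cvg (V : normedModType R[i]) (u : nat -> V) (a : V) : Prop :=
  forall e : R, 0 < e -> exists N, forall m, (N <= m)%N -> nrm (u m - a) <= e.

Definition nrm_cauchy (V : normedModType R[i]) (u : nat -> V) : Prop :=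
  forall e : R, 0 < e -> exists N, forall m k, (N <= m)%N -> (N <= k)%N ->
    nrm (u m - u k) <= e.

Definition nrm_complete (V : normedModType R[i]) : Prop :=
  forall u : nat -> V, nrm_cauchy u -> exists a, nrm_cvg u a.

Lemma completeP (X : completeNormedModType R[i]) : nrm_complete X.
Proof.
move=> u u_cauchy.
have : cvg (u @ \oo).
  apply/cauchy_cvgP/cauchy_exP => e e0.
  have eE : e = (complex.Re e)%:C by apply/esym/RRe_real; exact: gtr0_real.
  have e2 : 0 < complex.Re e / 2.
    by move: e0; rewrite eE ltcR => e0; rewrite divr_gt0.
  have [N hN] := u_cauchy _ e2; exists (u N); exists N => // m Nm.
  rewrite /= -ball_normE /= nrmE eE ltcR.
  by have := hN N m (leqnn _) Nm; lra.
move=> /cvgrPdist_le h.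
exists (lim (u @ \oo)) => e e0.
have := h e%:C; rewrite ltcR => /(_ e0) [N _ hN].
exists N => m Nm; rewrite nrm_distC -lecR -nrmE.
exact: hN.
Qed.

(** The coordinates converge to some [a]. In finite sums of squares the Cauchy estimate passes to
    the limit, with a bound independent of the index list [s], hence it holds for the full norm. *)
Lemma l2_complete (V : normedModType R[i]) :
  nrm_complete V -> nrm_complete (l2 V).
Proof.
move=> V_complete u u_cauchy.
have /choice[a ua] (j : int) : exists a, nrm_cvg (fun m => u m j) a.
  apply: V_complete => e e0; have [N hN] := u_cauchy e e0.
  exists N => m k Nm Nk; apply: le_trans (hN m k Nm Nk).
  exact: (@nrm_le_l2norm _ _ (u m - u k)).
have tail e : 0 < e -> exists N, forall m, (N <= m)%N -> forall s, uniq s ->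
    \sum_(j <- s) nrm (u m j - a j) ^+ 2 <= e ^+ 2.
  move=> e0; have [N hN] := u_cauchy e e0; exists N => m Nm s s_uniq.
  have lim_s : (fun k => \sum_(j <- s) nrm (u m j - u k j) ^+ 2) @ \oo -->
      \sum_(j <- s) nrm (u m j - a j) ^+ 2.
    apply: cvg_big => [|j _]; first exact: add_continuous.
    have c : (fun k => nrm (u m j - u k j)) @ \oo --> nrm (u m j - a j).
      apply/cvgrPdist_le => d d0; have [K hK] := ua j d d0.
      exists K => // k /= Kk.
      have uua : (u m j - u k j) - (u m j - a j) = a j - u k j.
        by rewrite opprB addrC addrA subrK.
      rewrite ler_norml; have := hK k Kk; rewrite nrm_distC.
      have := ler_nrmB (u m j - u k j) (u m j - a j); rewrite uua.
      have := ler_nrmB (u m j - a j) (u m j - u k j).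
      by rewrite [X in _ <= X]nrm_distC uua; lra.
    by under eq_fun do rewrite expr2; rewrite expr2; exact: cvgM.
  rewrite -(cvg_lim _ lim_s)//; apply: limr_le.
    by apply/cvg_ex; eexists; exact: lim_s.
  exists N => // k /= Nk.
  apply: (le_trans (@seq_le_l2norm _ _ (u m - u k) s s_uniq)).
  by rewrite ler_pXn2r ?nnegrE ?l2norm_ge0 ?(ltW e0)//; exact: hN.
have [N1 hN1] := tail 1 ltr01.
have da : (fun j => u N1 j - a j) \in @l2_pred R V.
  by rewrite /l2_pred unfold_in (le_lt_trans (sqsum_le (hN1 N1 (leqnn _)))) ?ltry.
pose b : l2 V := u N1 - L2 da.
have bE j : b j = a j by rewrite l2_addE l2_oppE /= opprB addrC subrK.
exists b => e e0; have [N hN] := tail e e0.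
exists N => m Nm; rewrite nrm_l2E; apply: l2norm_le; first exact: ltW.
apply: sqsum_le => s s_uniq.
under eq_bigr do rewrite l2_addE l2_oppE bE.
exact: hN.
Qed.

End Completeness.

(** * The dual of l^2(Z, V) *)

Section DualOfL2.
Variables (R : realType) (V : normedModType R[i]).

Lemma cauchy_schwarz_seq (I : Type) (s : seq I) (a b : I -> R) :
  (\sum_(j <- s) a j * b j) ^+ 2 <=
  (\sum_(j <- s) a j ^+ 2) * (\sum_(j <- s) b j ^+ 2).
Proof.
elim: s => [|i s IHs]; first by rewrite !big_nil expr0n /= mul0r.
rewrite !big_cons.
have A0 : 0 <= \sum_(j <- s) a j ^+ 2 by apply: sumr_ge0 => j _; exact: sqr_ge0.
have B0 : 0 <= \sum_(j <- s) b j ^+ 2 by apply: sumr_ge0 => j _; exact: sqr_ge0.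
move: IHs A0 B0; set P := \sum_(j <- s) _; set A := \sum_(j <- s) _.
set B := \sum_(j <- s) _ => IHs A0 B0.
(* The cross term is controlled by [P ^+ 2 <= A * B] and the arithmetic-geometric mean
   inequality. *)
suff : 2 * (P * (a i * b i)) <= A * b i ^+ 2 + B * a i ^+ 2 by nra.
have RHS0 : 0 <= A * b i ^+ 2 + B * a i ^+ 2.
  by rewrite addr_ge0// mulr_ge0// sqr_ge0.
rewrite (le_trans (ler_norm _))// -(@ler_pXn2r _ 2) ?nnegrE//.
rewrite real_normK ?num_real//.
rewrite (@le_trans _ _ (4 * (A * B) * (a i * b i) ^+ 2))//.
  by have := ler_wpM2r (sqr_ge0 (a i * b i)) IHs; lra.
by rewrite -subr_ge0; have := sqr_ge0 (A * b i ^+ 2 - B * a i ^+ 2); lra.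
Qed.

(** A nearly norming [u] in the unit ball is rotated so that [g] takes the value [|g u|], then
    scaled by [nrm g]; the loss [c < 1] is there because the norm of [g] need not be attained. *)
Lemma dual_almost_norming (g : dual V) (c : R) : 0 < c -> c < 1 ->
  exists v r, [/\ nrm v <= nrm g, g v = r%:C & c * nrm g ^+ 2 <= r].
Proof.
move=> c0 c1; have [g0|gN0] := eqVneq (nrm g) 0.
  by exists 0, 0; rewrite nrm0 g0 linear0 expr0n mulr0.
have g_gt0 : 0 < nrm g by rewrite lt_neqAle eq_sym gN0 nrm_ge0.
have [u [u1 hu]] : exists u, nrm u <= 1 /\ c * nrm g <= nrm (g u).
  apply: contrapT => hN.
  have : nrm g <= c * nrm g.
    rewrite {1}nrm_bopE; apply: ge_sup.
      by exists (nrm (g 0)), 0 => //=; rewrite nrm0.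
    move=> _ [u u1 <-]; rewrite leNgt; apply/negP => /ltW h.
    by apply: hN; exists u.
  by rewrite ler_pMl// leNgt c1.
have gu0 : `|g u| != 0.
  rewrite nrmE; apply/negP => /eqP /complexI h.
  by move: hu; rewrite h leNgt mulr_gt0.
exists ((nrm g)%:C *: ((((g u : R[i])^*)%C / `|g u|) *: u)), (nrm g * nrm (g u)); split.
- rewrite nrmZr nrmZ gtr0_norm// ler_piMr ?nrm_ge0//.
  rewrite normrM normrV ?unitfE// normr_id normcJ mulfV//= mul1r //.
- rewrite linearZ linearZ/= rmorphM/= -nrmE; congr (_ * _).
  rewrite -[LHS]/((g u : R[i])^*%C / `|g u| * g u).
  by rewrite mulrAC -[X in X / _]mulrC -sqr_normc expr2 mulfK.
- by rewrite expr2 mulrCA ler_pM2l.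
Qed.

Lemma single_op_subproof j : single j \in @bounded_linear_pred R V (l2 V).
Proof.
apply/asboolP; split => [a u v|].
  apply: l2_ext => i; rewrite l2_addE l2_scaleE !singleE.
  by case: eqP => // _; rewrite scaler0 addr0.
by exists 1 => v; rewrite mul1r nrm_l2E l2norm_single.
Qed.

Definition single_op j : 'L(V, l2 V) := Bop (single_op_subproof j).

Lemma coord_op_subproof j :
  (fun x : l2 V => x j) \in @bounded_linear_pred R (l2 V) V.
Proof.
apply/asboolP; split => // ; exists 1 => x; rewrite mul1r.
exact: nrm_le_l2norm.
Qed.

Definition coord_op j : 'L(l2 V, V) := Bop (coord_op_subproof j).

Definition coef_fun (F : dual (l2 V)) (j : int) : dual V :=
  bop_comp F (single_op j).

Lemma dual_trunc (F : dual (l2 V)) s (x : int -> V) : uniq s ->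
  F (trunc s x) = \sum_(j <- s) coef_fun F j (x j).
Proof. by move=> s_uniq; rewrite trunc_sum// linear_sum. Qed.

(** [F] is tested on a finite sequence whose [j]-th term is almost norming for the [j]-th
    coefficient: [c * Y <= |F| * sqrt Y]. Dividing by [sqrt Y] and letting [c] tend to [1] gives the
    bound. *)
Lemma coef_fun_le (F : dual (l2 V)) s : uniq s ->
  \sum_(j <- s) nrm (coef_fun F j) ^+ 2 <= nrm F ^+ 2.
Proof.
move=> s_uniq; set Y := \sum_(j <- s) _.
have Y0 : 0 <= Y by apply: sumr_ge0 => j _; exact: sqr_ge0.
suff h (c : R) : 0 < c -> c < 1 -> c * Num.sqrt Y <= nrm F.
  rewrite -[leLHS]sqr_sqrtr// ler_pXn2r ?nnegrE ?sqrtr_ge0 ?nrm_ge0//.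
  rewrite leNgt; apply/negP => FY.
  have y0 : 0 < Num.sqrt Y := le_lt_trans (nrm_ge0 F) FY.
  (* If [nrm F < sqrt Y], this [c] makes [c * sqrt Y] the midpoint of the two, which exceeds
     [nrm F]. *)
  have := h ((nrm F + Num.sqrt Y) / 2 / Num.sqrt Y).
  rewrite mulfVK ?gt_eqF// ltr_pdivrMr// mul1r divr_gt0 ?divr_gt0 ?ltr_wpDl ?nrm_ge0//.
  by move=> /(_ isT) h'; have := h' ltac:(lra); lra.
move=> c0 c1.
have /choice[v hv] (j : int) : exists v, exists r, [/\ nrm v <= nrm (coef_fun F j),
    coef_fun F j v = r%:C & c * nrm (coef_fun F j) ^+ 2 <= r].
  exact: dual_almost_norming.
have /choice[r {}hv] := hv.
have : c * Y <= nrm F * l2norm (trunc s v).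
  apply: le_trans (opnormP F (trunc s v)).
  rewrite dual_trunc// (eq_bigr (fun j => (r j)%:C)) => [|j _]; last first.
    by have [] := hv j.
  rewrite -rmorph_sum /nrm normc_def /= expr0n /= addr0 sqrtr_sqr.
  rewrite (le_trans _ (ler_norm _))// mulr_sumr ler_sum// => j _.
  by have [] := hv j.
have : l2norm (trunc s v) <= Num.sqrt Y.
  rewrite -(@ler_pXn2r _ 2) ?nnegrE ?sqrtr_ge0 ?l2norm_ge0//.
  rewrite l2norm_trunc// sqr_sqrtr// ler_sum// => j _.
  by rewrite ler_pXn2r ?nnegrE ?nrm_ge0//; have [] := hv j.
move=> /(ler_wpM2l (nrm_ge0 F)) /[swap] /le_trans/[apply].
rewrite -{1}(sqr_sqrtr Y0) expr2 mulrA.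
have [->|yN0] := eqVneq (Num.sqrt Y) 0; first by rewrite !mulr0 nrm_ge0.
by rewrite ler_pM2r// lt_neqAle eq_sym yN0 sqrtr_ge0.
Qed.

Lemma coef_subproof (F : dual (l2 V)) : coef_fun F \in @l2_pred R (dual V).
Proof.
by rewrite /l2_pred unfold_in (le_lt_trans (sqsum_le (coef_fun_le F))) ?ltry.
Qed.

Definition coef (F : dual (l2 V)) : l2 (dual V) := L2 (coef_subproof F).

Lemma coefE (F : dual (l2 V)) j v : coef F j v = F (single j v).
Proof. by []. Qed.

(** One inequality is [coef_fun_le]; for the other, Cauchy-Schwarz bounds [F] on truncations of [x],
    and the truncation error is made at most [e]. *)
Lemma l2norm_coef (F : dual (l2 V)) : l2norm (coef F) = nrm F.
Proof.
apply/eqP; rewrite eq_le; apply/andP; split.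
  apply: l2norm_le; first exact: nrm_ge0.
  by apply: sqsum_le; exact: coef_fun_le.
rewrite nrm_bopE; apply: opnorm_le => [|x]; first exact: l2norm_ge0.
apply/ler_addgt0Pr => e e0.
have d0 : 0 < e / (nrm F + 1) by rewrite divr_gt0// ltr_wpDl ?nrm_ge0.
have [s s_uniq hs] := trunc_dense x d0.
rewrite -[x in X in X <= _](subrK (trunc s x)) linearD addrC.
apply: (le_trans (ler_nrmD _ _)); apply: lerD; last first.
  apply: (le_trans (opnormP _ _)).
  apply: (le_trans (ler_wpM2l (opnorm_ge0 _) hs)).
  rewrite mulrCA ler_piMr ?(ltW e0)//.
  by rewrite ler_pdivrMr ?ltr_wpDl ?nrm_ge0// mul1r lerDl.
rewrite -[X in nrm X <= _]/(F (trunc s x)) dual_trunc//.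
apply: (@le_trans _ _ (\sum_(j <- s) nrm (coef F j) * nrm (x j))).
  elim: s {s_uniq hs} => [|j s IHs]; first by rewrite !big_nil nrm0.
  rewrite !big_cons (le_trans (ler_nrmD _ _))// lerD//.
  exact: opnormP.
have P0 : 0 <= \sum_(j <- s) nrm (coef F j) * nrm (x j).
  by apply: sumr_ge0 => j _; rewrite mulr_ge0 ?nrm_ge0.
rewrite -(@ler_pXn2r _ 2) ?nnegrE ?mulr_ge0 ?l2norm_ge0//.
apply: (le_trans (cauchy_schwarz_seq _ _ _)).
rewrite exprMn ler_pM ?seq_le_l2norm//; apply: sumr_ge0 => j _; exact: sqr_ge0.
Qed.

Lemma coef_finite_support (y : l2 (dual V)) s : uniq s ->
  (forall j, j \notin s -> y j = 0) -> exists F, coef F = y.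
Proof.
move=> s_uniq ys.
pose F : dual (l2 V) := \sum_(j <- s) bop_comp (y j) (coord_op j).
exists F; apply: l2_ext => i; apply: bop_ext => v; rewrite coefE.
have FE x : F x = \sum_(j <- s) y j (x j).
  rewrite /F; elim: (s) => [|j r IHr]; first by rewrite !big_nil.
  by rewrite !big_cons bop_addE IHr.
rewrite FE; case: (boolP (i \in s)) => [si|/[dup] si /ys ->].
  rewrite (bigD1_seq i)// singleE eqxx big1 => [|j /negbTE ji]; first exact: addr0.
  by rewrite singleE ji linear0.
rewrite big_seq big1// => j js; rewrite singleE.
by case: eqP => [ji|]; [move: si; rewrite -ji js|rewrite linear0].
Qed.

Lemma tridiag_op_single (A : tridiag V) i v :
  tridiag_op A (single i v) =
  single (i - 1) (gamma A i v) + single i (beta A i v)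
  + single (i + 1) (alpha A i v).
Proof.
apply: l2_ext => j; rewrite tridiag_opE !l2_addE !singleE.
have -> : (j - 1 == i) = (j == i + 1) by rewrite subr_eq.
have -> : (j + 1 == i) = (j == i - 1) by rewrite -subr_eq opprK.
rewrite [RHS]addrC [X in _ = _ + X]addrC [RHS]addrA.
by congr (_ + _ + _); case: eqP => [->|_]; rewrite ?addrK ?subrK ?linear0.
Qed.

(** Tested on [single i v], only column [i] of [A] contributes, and its three entries give row [i]
    of the adjoint matrix. Through [coef], the matrix adjoint is thus the Banach space adjoint. *)
Lemma coef_comp_tridiag (A : tridiag V) (F : dual (l2 V)) :
  coef (bop_comp F (tridiag_op A)) = tridiag_op (tridiag_adj A) (coef F).
Proof.
apply: l2_ext => i; rewrite tridiag_opE /= subrK addr0 addrK.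
apply: bop_ext => v; rewrite coefE.
rewrite -[LHS]/(F (tridiag_op A (single i v))) tridiag_op_single !linearD.
by [].
Qed.

End DualOfL2.

(** * Invertibility of operators bounded below *)

Section Invertibility.
Variable R : realType.

(** The Bohnenblust-Sobczyk passage from a real-linear functional to the complex-linear one with
    real part [f]. *)
Lemma complex_functional (W : lmodType R[i]) (f : W -> R) :
  (forall u v, f (u + v) = f u + f v) ->
  (forall (t : R) v, f (t%:C *: v) = t * f v) ->
  linear (fun v => (f v +i* - f ('i%C *: v))%C : R[i]^o).
Proof.
move=> fD fZ [s t] u v.
have aE : (s +i* t)%C = s%:C + 'i%C * t%:C :> R[i].
  by apply/eqP; rewrite eq_complex /= !mul0r !mul1r !subr0 addr0 !add0r !eqxx.
have iaE : 'i%C * (s +i* t)%C = 'i%C * s%:C - t%:C :> R[i].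
  apply/eqP; rewrite eq_complex /= !mul0r !mul1r !subr0.
  by rewrite ?addr0 ?add0r ?oppr0 ?sub0r !eqxx.
have fN w : f (- w) = - f w.
  by rewrite -scaleN1r -(rmorphN1 (real_complex R)) fZ mulN1r.
have fiZ (r : R) w : f (('i%C * r%:C) *: w) = r * f ('i%C *: w).
  by rewrite mulrC -scalerA fZ.
rewrite scalerDr scalerA !fD iaE aE !scalerDl scaleNr !fD fN !fZ !fiZ.
apply/eqP; rewrite eq_complex /=; apply/andP; split; apply/eqP.
  by lra.
by lra.
Qed.

(** The distance [p] to the range of [B] is sublinear. A real-linear [f <= p] with [f z >= p z >= d]
    vanishes on the range but not at [z]. *)
Lemma range_annihilator (V W : normedModType R[i]) (B : 'L(V, W)) (z : W) (d : R) :
  0 < d -> (forall x, d <= nrm (z - B x)) ->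
  exists2 F : dual W, F != 0 & bop_comp F B = 0.
Proof.
move=> d0 hz.
pose p v := inf [set nrm (v - B x) | x in [set: V]].
have ple v x : p v <= nrm (v - B x).
  by apply: ge_inf; [exists 0 => _ [u _ <-]; exact: nrm_ge0|exists x].
have lep (m : R) v : (forall x, m <= nrm (v - B x)) -> m <= p v.
  move=> h; apply: lb_le_inf; first by exists (nrm (v - B 0)), 0.
  by move=> _ [x _ <-].
have p_sub : sublinear p.
  split => [u v|t v t0].
    suff H x : p (u + v) - nrm (u - B x) <= p v.
      by rewrite -lerBlDr; apply: lep => x; have := H x; lra.
    apply: lep => y; have := ple (u + v) (x + y); rewrite linearD opprD addrACA.
    by have := ler_nrmD (u - B x) (v - B y); lra.
  rewrite mulrC -ler_pdivrMr//; apply: lep => x; rewrite ler_pdivrMr//.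
  apply: (le_trans (ple _ (t%:C *: x))).
  by rewrite linearZ -scalerBr nrmZr gtr0_norm// mulrC.
have [f [fD fZ fp fz]] := hahn_banach z p_sub.
have f_le v : `|f v| <= nrm v.
  have H u : f u <= nrm u.
    by apply: le_trans (fp u) _; have := ple u 0; rewrite linear0 subr0.
  rewrite ler_norml H andbT lerNl -mulN1r -fZ rmorphN1 scaleN1r.
  by rewrite (le_trans (H _))// nrmN.
have fB x : f (B x) = 0.
  have H u : f (B u) <= 0.
    by apply: le_trans (fp _) _; have := ple (B u) u; rewrite subrr nrm0.
  apply/eqP; rewrite eq_le H/= -oppr_le0 -mulN1r -fZ rmorphN1 scaleN1r.
  by rewrite -linearN H.
have F_bounded : (fun v => (f v +i* - f ('i%C *: v))%C : R[i]^o) \in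
    @bounded_linear_pred R W R[i]^o.
  apply/asboolP; split; first exact: complex_functional.
  exists 2 => v; rewrite mulr_natl mulr2n.
  have i1 : nrm ('i%C *: v) = nrm v.
    by rewrite nrmZ normc_def /= expr0n expr1n /= add0r sqrtr1 mul1r.
  rewrite /nrm normc_def /= sqrrN.
  apply: (@le_trans _ _ (`|f v| + `|f ('i%C *: v)|)); last first.
    by rewrite lerD// -[leRHS]i1.
  rewrite -[leRHS]ger0_norm ?addr_ge0// -sqrtr_sqr ler_wsqrtr// sqrrD.
  by rewrite !real_normK ?num_real// lerD2r lerDl mulrn_wge0// mulr_ge0.
exists (Bop F_bounded); last first.
  apply: bop_ext => x; rewrite /= -linearZ !fB oppr0.
  by apply/eqP; rewrite eq_complex /= !eqxx.
apply/eqP => /(congr1 (fun F : dual W => complex.Re (F z))) /= fz0.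
by have := le_trans (lep d z hz) fz; rewrite fz0 leNgt d0.
Qed.

(** Density provides [u m] with [B (u m)] tending to [z]; the lower bound makes [u] Cauchy, and its
    limit is a preimage of [z]. The same bound gives injectivity and the norm of the inverse. *)
Lemma bounded_below_inverse (V : normedModType R[i]) (B : 'L(V)) (c : R) :
  nrm_complete V -> 0 < c -> (forall x, c * nrm x <= nrm (B x)) ->
  (forall z (e : R), 0 < e -> exists x, nrm (z - B x) <= e) ->
  exists2 C, is_inverse B C & nrm C <= c^-1.
Proof.
move=> V_complete c0 Bc B_dense.
have Bc' x : nrm x <= c^-1 * nrm (B x) by rewrite ler_pdivlMl.
have B_inj x y : B x = B y -> x = y.
  move=> Bxy; apply/eqP; rewrite -subr_eq0; apply/eqP/nrm0_eq0/eqP.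
  rewrite eq_le nrm_ge0 andbT; apply: (le_trans (Bc' _)).
  by rewrite linearB /= Bxy subrr nrm0 mulr0.
have /choice[C CK] z : exists x, B x = z.
  have /choice[u hu] (m : nat) : exists x, nrm (z - B x) <= m.+1%:R^-1.
    by apply: B_dense; rewrite invr_gt0.
  have hcvg (e : R) : 0 < e -> exists N, forall m, (N <= m)%N -> nrm (z - B (u m)) <= e.
    move=> e0; have [N hN] : exists N, forall m, (N <= m)%N -> m.+1%:R^-1 <= e.
      exists (Num.truncn e^-1) => m Nm.
      rewrite invf_ple ?posrE// (le_trans (ltW (truncnS_gt _)))//.
      by rewrite ler_nat.
    by exists N => m /hN; exact: le_trans.
  have u_cauchy : nrm_cauchy u.
    (* Two errors of size [c * e / 2] in the image become [e] after division by [c]. *)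
    move=> e e0; have [N hN] := hcvg (c * e / 2) ltac:(by rewrite divr_gt0 ?mulr_gt0).
    exists N => m k Nm Nk; apply: (le_trans (Bc' _)); rewrite ler_pdivrMl//.
    rewrite linearB /= -(subrKA z) (le_trans (ler_nrmD _ _))// [nrm (_ - z)]nrm_distC.
    by have := hN m Nm; have := hN k Nk; lra.
  have [a ua] := V_complete _ u_cauchy.
  exists a; apply/eqP; rewrite -subr_eq0; apply/eqP/nrm0_eq0/eqP.
  rewrite eq_le nrm_ge0 andbT; apply/ler_addgt0Pr => e e0; rewrite add0r.
  have K0 : 0 < nrm B + 1 by rewrite ltr_wpDl ?nrm_ge0.
  have [N hN] := hcvg (e / 2) ltac:(by rewrite divr_gt0).
  have [M hM] := ua (e / 2 / (nrm B + 1)) ltac:(by rewrite !divr_gt0).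
  have := hM _ (leq_maxr N M); have := hN _ (leq_maxl N M).
  set m := maxn N M => h1 h2.
  rewrite -(subrKA (B (u m))) (le_trans (ler_nrmD _ _))// [nrm (_ - z)]nrm_distC.
  suff : nrm (B a - B (u m)) <= e / 2 by lra.
  rewrite -linearB (le_trans (opnormP _ _))// nrm_distC.
  apply: le_trans (ler_wpM2l (opnorm_ge0 _) h2) _.
  rewrite mulrCA ler_piMr ?divr_ge0 ?(ltW e0)//.
  by rewrite ler_pdivrMr// mul1r lerDl.
have C_bounded : C \in @bounded_linear_pred R V V.
  apply/asboolP; split; last by exists c^-1 => v; rewrite -{2}(CK v).
  by move=> a u v; apply: B_inj; rewrite linearP /= !CK.
exists (Bop C_bounded); first by split => [x|z]; [exact: B_inj|exact: CK].
rewrite nrm_bopE; apply: opnorm_le; first by rewrite invr_ge0 ltW.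
by move=> v; rewrite -{2}(CK v).
Qed.

(** If the range were not dense, a nonzero [F] would annihilate it, and [coef F] would be a nonzero
    kernel vector of the adjoint matrix, against its lower bound. *)
Lemma tridiag_inverse (V : normedModType R[i]) (A : tridiag V) (c : R) :
  nrm_complete V -> 0 < c ->
  (forall x, c * nrm x <= nrm (tridiag_op A x)) ->
  (forall y, c * nrm y <= nrm (tridiag_op (tridiag_adj A) y)) ->
  exists2 C, is_inverse (tridiag_op A) C & nrm C <= c^-1.
Proof.
move=> V_complete c0 Ac Ac'; apply: bounded_below_inverse => //.
  exact: l2_complete.
move=> z e e0; apply: contrapT => hN.
have [F F0 FA] : exists2 F : dual (l2 V), F != 0 & bop_comp F (tridiag_op A) = 0.
  apply: (@range_annihilator _ _ _ z e) => // x.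
  by rewrite leNgt; apply/negP => /ltW h; apply: hN; exists x.
have := Ac' (coef F); rewrite -coef_comp_tridiag FA !nrm_l2E !l2norm_coef nrm0 => cF.
move/eqP: F0; apply; apply/nrm0_eq0/eqP.
by rewrite eq_le nrm_ge0 andbT -(pmulr_rle0 _ c0).
Qed.

(** [F = (F o A) o C] gives [|F| <= |C| |F o A|], which the isometry [coef] carries over to
    sequences. *)
Lemma inverse_bounds_adjoint (V : normedModType R[i]) (A : tridiag V)
    (C : 'L(l2 V)) (y : l2 (dual V)) s :
  is_inverse (tridiag_op A) C -> uniq s -> (forall j, j \notin s -> y j = 0) ->
  nrm y <= nrm C * nrm (tridiag_op (tridiag_adj A) y).
Proof.
move=> [_ AC] s_uniq /(coef_finite_support s_uniq)[F <-].
rewrite -coef_comp_tridiag !nrm_l2E !l2norm_coef.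
have {1}-> : F = bop_comp (bop_comp F (tridiag_op A)) C.
  by apply: bop_ext => x; rewrite -[RHS]/(F (tridiag_op A (C x))) AC.
exact: opnorm_comp.
Qed.

End Invertibility.

(** * Sine weights and localization *)

Section SineWeights.
Variables (R : realType) (n : nat).

Let theta : R := pi / n.+1%:R.

(** The values agree with the sine at every integer from [0] to [n + 1]: at [n + 1] the default [0]
    equals [sin pi]. *)
Definition sine_weight (j : int) : R :=
  if (0 <= j <= n%:Z) then sin (`|j|%N%:R * theta) else 0.

Lemma sine_weight0 j : ~~ (1 <= j <= n%:Z) -> sine_weight j = 0.
Proof.
rewrite /sine_weight; case: ifPn => // j1 j2.
have -> : `|j|%N = 0%N by lia.
by rewrite mul0r sin0.
Qed.

Lemma sine_weight_nat m : (m <= n.+1)%N ->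
  sine_weight m%:Z = sin (m%:R * theta).
Proof.
rewrite leq_eqVlt ltnS => /predU1P[->|mn]; last first.
  by rewrite /sine_weight ifT// lez_nat.
rewrite sine_weight0; last lia.
by rewrite /theta mulrC mulfVK ?pnatr_eq0// sinpi.
Qed.

Definition sine_mass : R := \sum_(m < n.+1) sine_weight m%:Z ^+ 2.

Lemma sine_mass_gt0 : (0 < n)%N -> 0 < sine_mass.
Proof.
move=> n0; rewrite /sine_mass (bigD1 (Ordinal (n0 : 1 < n.+1)%N))//=.
rewrite ltr_wpDr ?sumr_ge0// => [i _|]; first exact: sqr_ge0.
rewrite exprn_gt0// sine_weight_nat// mul1r sin_gt0_pi//.
rewrite divr_gt0 ?pi_gt0//= ltr_pdivrMr// ltr_pMr ?pi_gt0//.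
by rewrite ltr1n ltnS.
Qed.

(** Square root of the least eigenvalue [2 - 2 cos theta] of the discrete Dirichlet Laplacian on [n]
    points; in [eps2] it multiplies the norms of the off-diagonals. *)
Definition sine_gap : R := 2 * sin (pi / (2 * n.+1%:R)).

Lemma sine_gap_gt0 : 0 < sine_gap.
Proof.
rewrite mulr_gt0// sin_gt0_pi// divr_gt0 ?pi_gt0//=.
rewrite ltr_pdivrMr// ltr_pMr ?pi_gt0//.
by rewrite -natrM ltr1n; lia.
Qed.

Lemma sine_gapE : sine_gap ^+ 2 = 2 - 2 * cos theta.
Proof.
have -> : theta = (pi / (2 * n.+1%:R)) *+ 2.
  rewrite /theta -mulr_natr; have : n.+1%:R != 0 :> R by rewrite pnatr_eq0.
  by move: (n.+1%:R : R) => N N0; field.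
rewrite cos_mulr2n /sine_gap exprMn; have := cos2Dsin2 (pi / (2 * n.+1%:R) : R).
by lra.
Qed.

(* Summation by parts and the eigenvalue relation
   [s (m - 1) + s (m + 1) = 2 cos theta * s m] of the discrete Laplacian;
   the boundary term vanishes for [N = n + 1]. *)
Lemma sine_energy_partial (N : nat) (s := fun m : nat => sin (m%:R * theta) : R) :
  \sum_(m < N) (s m.+1 - s m) ^+ 2 =
  (2 - 2 * cos theta) * \sum_(m < N) s m ^+ 2
  + s N ^+ 2 - 2 * cos theta * s N ^+ 2 + s N * s N.+1.
Proof.
have rec m : s m.+2 = 2 * cos theta * s m.+1 - s m.
  have -> : s m.+2 = sin (m.+1%:R * theta + theta).
    by rewrite /s -[in LHS]natr1 mulrDl mul1r.
  have -> : s m = sin (m.+1%:R * theta - theta).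
    by rewrite /s -[in RHS]natr1 mulrDl mul1r addrK.
  by rewrite sinB sinD /s; lra.
elim: N => [|N IHN].
  by rewrite !big_ord0 /s mul0r sin0; lra.
by rewrite !big_ord_recr /= IHN rec; lra.
Qed.

Lemma sine_energy :
  \sum_(m < n.+1) (sine_weight (m%:Z + 1) - sine_weight m%:Z) ^+ 2 =
  sine_gap ^+ 2 * sine_mass.
Proof.
have sn : sin (n.+1%:R * theta) = 0 by rewrite -sine_weight_nat// sine_weight0//; lia.
have := sine_energy_partial n.+1; rewrite /= sn mul0r expr0n /= !mulr0 subr0 !addr0.
rewrite sine_gapE /sine_mass => h.
rewrite [RHS](_ : _ = (2 - 2 * cos theta) * (\sum_(m < n.+1) sin (m%:R * theta) ^+ 2)).
  rewrite -h; apply: eq_bigr => m _.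
  by rewrite -PoszD addn1 !sine_weight_nat// ltnW.
by congr (_ * _); apply: eq_bigr => m _; rewrite sine_weight_nat// ltnW.
Qed.

Lemma esum_sine_weight (i : int) (c : R) : 0 <= c ->
  \esum_(k in [set: int]) (c * sine_weight (i - k) ^+ 2)%:E =
  (c * sine_mass)%:E.
Proof.
move=> c0; rewrite (@esum_convolution _ c (fun j => sine_weight j ^+ 2) n.+1)//.
  by move=> j; exact: sqr_ge0.
by move=> j jn; rewrite sine_weight0 ?expr0n//; lia.
Qed.

Lemma esum_sine_weight_diff (i : int) (c : R) : 0 <= c ->
  \esum_(k in [set: int])
    (c * (sine_weight (i - k + 1) - sine_weight (i - k)) ^+ 2)%:E =
  (c * (sine_gap ^+ 2 * sine_mass))%:E.
Proof.
move=> c0.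
rewrite (@esum_convolution _ c
  (fun j => (sine_weight (j + 1) - sine_weight j) ^+ 2) n.+1)//.
- by rewrite sine_energy.
- by move=> j; exact: sqr_ge0.
(* The difference at [j] involves [j] and [j + 1], so it is supported in [0, ..., n]. *)
- by move=> j jn; rewrite !sine_weight0 ?subrr ?expr0n//; lia.
Qed.

End SineWeights.

(** * From bounds on all windows to a global lower bound *)

Section Localization.
Variables (R : realType) (V : normedModType R[i]) (A : tridiag V) (n : nat).

(** Cauchy-Schwarz with free weights, the gap being a sum of squares. Equality holds when [a, b, c]
    are proportional to [s, t, u], so well-chosen weights recover Minkowski's inequality without
    loss. *)
Lemma sqr_sum3_le (a b c s t u : R) : 0 < s -> 0 < t -> 0 < u ->
  (a + b + c) ^+ 2 <= (s + t + u) * (a ^+ 2 / s + b ^+ 2 / t + c ^+ 2 / u).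
Proof.
move=> s0 t0 u0; rewrite -subr_ge0.
have -> : (s + t + u) * (a ^+ 2 / s + b ^+ 2 / t + c ^+ 2 / u) - (a + b + c) ^+ 2 =
    (t * a - s * b) ^+ 2 / (s * t) + (u * a - s * c) ^+ 2 / (s * u)
    + (u * b - t * c) ^+ 2 / (t * u).
  by field; rewrite !gt_eqF.
by rewrite !addr_ge0// divr_ge0 ?sqr_ge0// mulr_ge0// ltW.
Qed.

Let w := @sine_weight R n.

Definition window_seq (k : int) : seq int := [seq k + m%:Z | m <- iota 1 n].

Lemma window_seq_uniq k : uniq (window_seq k).
Proof. by rewrite map_inj_uniq ?iota_uniq// => i j /addrI []. Qed.

Lemma mem_window_seq k j : (j \in window_seq k) = (k + 1 <= j <= k + n%:Z).
Proof.
apply/mapP/idP => [[m]|h]; first by rewrite mem_iota => h ->; lia.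
by exists `|j - k|%N; [rewrite mem_iota; lia|lia].
Qed.

Definition window (k : int) (x : l2 V) : l2 V :=
  trunc (window_seq k) (fun j => (w (j - k))%:C *: x j).

Lemma windowE k x j : window k x j = (w (j - k))%:C *: x j.
Proof.
rewrite truncE mem_window_seq; case: ifPn => // h.
by rewrite /w sine_weight0 ?scale0r//; lia.
Qed.

Lemma supported_window k x : supported_in n k (window k x).
Proof. by move=> j /negbTE h; rewrite truncE mem_window_seq h. Qed.

(** The diagonal [beta] commutes with the window; moving the weight across [alpha] or [gamma] costs
    a difference of neighbouring weights. *)
Lemma tridiag_op_window k x i : tridiag_op A (window k x) i =
  (w (i - k))%:C *: tridiag_op A x i
  - (w (i - k) - w (i - 1 - k))%:C *: alpha A (i - 1) (x (i - 1))
  + (w (i + 1 - k) - w (i - k))%:C *: gamma A (i + 1) (x (i + 1)).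
Proof.
have opZ (f : 'L(V)) (c : R[i]) v : f (c *: v) = c *: f v by rewrite linearZ.
rewrite !tridiag_opE !windowE !opZ !rmorphB /= !scalerBl !scalerDr.
set wa := _ *: alpha _ _ _; set wb := _ *: beta _ _ _.
set wc := _ *: gamma _ _ _; set wa' := _ *: alpha _ _ _.
set wc' := _ *: gamma _ _ _.
rewrite opprB -[wa' + wb + _]addrA [wa' + _ + _]addrC [wa - wa' + _]addrA.
rewrite subrK [wa + (_ + _)]addrA.
by rewrite [RHS]addrACA subrr addr0.
Qed.

(** With [r = |x|] and [b = |B x|], the target [m r <= b + p g r + q g r] is Minkowski's inequality
    over all pairs of a row [i] and a window [k]. It is reached through [sqr_sum3_le], the weights
    being the three terms on the right. *)
Lemma window_bound (m p q : R) : (0 < n)%N -> 0 <= m ->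
  (forall j, nrm (alpha A j) <= p) -> (forall j, nrm (gamma A j) <= q) ->
  (forall k y, supported_in n k y -> m * nrm y <= nrm (tridiag_op A y)) ->
  forall x, (m - (p + q) * sine_gap R n) * nrm x <= nrm (tridiag_op A x).
Proof.
move=> n0 m0 Ap Aq Am x; set B := tridiag_op A; set g := sine_gap R n.
have g0 : 0 < g by exact: sine_gap_gt0.
have p0 : 0 <= p by exact: le_trans (nrm_ge0 _) (Ap 0).
have q0 : 0 <= q by exact: le_trans (nrm_ge0 _) (Aq 0).
have [x0|xN0] := eqVneq (nrm x) 0; first by rewrite x0 mulr0 nrm_ge0.
set r := nrm x; have r0 : 0 < r by rewrite lt_neqAle eq_sym xN0 nrm_ge0.
set b := nrm (B x); have b0 : 0 <= b by exact: nrm_ge0.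
(* The perturbation keeps the weights positive when [b], [p] or [q] is [0]; it adds
   [e * (1 + 2 * g * r)] in total, which is arbitrarily small. *)
suff H (e : R) : 0 < e -> m * r <= (b + e) + (p + e) * g * r + (q + e) * g * r.
  apply/ler_addgt0Pr => e e0.
  have K0 : 0 < 1 + 2 * g * r by have := mulr_gt0 g0 r0; lra.
  have := H (e / (1 + 2 * g * r)) ltac:(by rewrite divr_gt0).
  set d := e / _; have : d * (1 + 2 * g * r) = e by rewrite mulfVK// gt_eqF.
  by move=> <-; lra.
move=> e0; have : exists s t u : R, [/\ b + e = s, (p + e) * g * r = t &
    (q + e) * g * r = u] by exists (b + e), ((p + e) * g * r), ((q + e) * g * r).
move=> [s [t [u [sE tE uE]]]]; rewrite sE tE uE.
have s0 : 0 < s by rewrite -sE ltr_wpDl.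
have t0 : 0 < t by rewrite -tE pmulr_lgt0// pmulr_lgt0// ltr_wpDl.
have u0 : 0 < u by rewrite -uE pmulr_lgt0// pmulr_lgt0// ltr_wpDl.
have [S SE] : exists S, s + t + u = S by eexists.
have S0 : 0 < S by rewrite -SE !addr_gt0.
rewrite SE; have [T TE] : exists T, T = sine_mass R n by eexists.
have T0 : 0 < T by rewrite TE sine_mass_gt0.
pose dw j := w (j + 1) - w j.
have wsum i (c : R) : 0 <= c ->
    \esum_(k in [set: int]) (c * w (i - k) ^+ 2)%:E = (c * T)%:E.
  by rewrite TE; exact: esum_sine_weight.
have dwsum i (c : R) : 0 <= c ->
    \esum_(k in [set: int]) (c * dw (i - k) ^+ 2)%:E = (c * (g ^+ 2 * T))%:E.
  by rewrite TE; exact: esum_sine_weight_diff.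
have lower k : (\esum_(i in [set: int]) (m ^+ 2 * nrm (x i) ^+ 2 * w (i - k) ^+ 2)%:E
    <= \esum_(i in [set: int]) (nrm (B (window k x) i) ^+ 2)%:E)%E.
  rewrite -[leRHS]/(sqsum (B (window k x))) sqsumE.
  apply: (@le_trans _ _ ((m * nrm (window k x)) ^+ 2)%:E); last first.
    rewrite lee_fin ler_pXn2r ?nnegrE ?mulr_ge0 ?nrm_ge0 ?l2norm_ge0//.
    exact/Am/supported_window.
  rewrite exprMn EFinM nrm_l2E -sqsumE -esumZl ?sqr_ge0// => [|j]; last exact: sqr_ge0.
  apply: le_esum => i _; rewrite lee_fin -mulrA windowE nrmZr exprMn.
  by rewrite real_normK ?num_real// [w _ ^+ 2 * _]mulrC.
(* The commutator formula splits row [i] into three terms, to which [sqr_sum3_le] applies with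
   weights [s, t, u]. *)
have upper k i : nrm (B (window k x) i) ^+ 2 <=
    S / s * nrm (B x i) ^+ 2 * w (i - k) ^+ 2
    + S * p ^+ 2 / t * nrm (x (i - 1)) ^+ 2 * dw (i - 1 - k) ^+ 2
    + S * q ^+ 2 / u * nrm (x (i + 1)) ^+ 2 * dw (i - k) ^+ 2.
  have -> : S / s * nrm (B x i) ^+ 2 * w (i - k) ^+ 2
    + S * p ^+ 2 / t * nrm (x (i - 1)) ^+ 2 * dw (i - 1 - k) ^+ 2
    + S * q ^+ 2 / u * nrm (x (i + 1)) ^+ 2 * dw (i - k) ^+ 2 =
    S * ((`|w (i - k)| * nrm (B x i)) ^+ 2 / s
      + (`|dw (i - 1 - k)| * (p * nrm (x (i - 1)))) ^+ 2 / t
      + (`|dw (i - k)| * (q * nrm (x (i + 1)))) ^+ 2 / u).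
    by rewrite !exprMn !real_normK ?num_real//; ring.
  rewrite -SE; apply: le_trans (sqr_sum3_le _ _ _ s0 t0 u0).
  rewrite ler_pXn2r ?nnegrE ?addr_ge0 ?mulr_ge0 ?nrm_ge0//.
  rewrite /B tridiag_op_window.
  rewrite (le_trans (ler_nrmD _ _))// lerD//; last first.
    rewrite nrmZr /dw addrAC ler_wpM2l// (le_trans (opnormP _ _))//.
    by rewrite ler_wpM2r ?nrm_ge0//; exact: Aq.
  rewrite (le_trans (ler_nrmD _ _))// lerD// ?nrmN nrmZr//.
  rewrite /dw [i - 1 - k + 1]addrAC subrK ler_wpM2l// (le_trans (opnormP _ _))//.
  by rewrite ler_wpM2r ?nrm_ge0//; exact: Ap.
have [cs csE] : exists c, S / s = c by eexists.
have [ct ctE] : exists c, S * p ^+ 2 / t = c by eexists.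
have [cu cuE] : exists c, S * q ^+ 2 / u = c by eexists.
rewrite csE ctE cuE in upper.
have cs0 : 0 <= cs by rewrite -csE divr_ge0// ltW.
have ct0 : 0 <= ct by rewrite -ctE divr_ge0 ?(ltW t0)// mulr_ge0 ?sqr_ge0// ltW.
have cu0 : 0 <= cu by rewrite -cuE divr_ge0 ?(ltW u0)// mulr_ge0 ?sqr_ge0// ltW.
have sqsum_scale (U : normedModType R[i]) (c : R) (z : l2 U) (d : int) : 0 <= c ->
    \esum_(i in [set: int]) (c * nrm (z (i + d)) ^+ 2)%:E = (c * nrm z ^+ 2)%:E.
  move=> c0; rewrite (esumZl (a := fun i => nrm (z (i + d)) ^+ 2))// => [|j].
    by rewrite -/(sqsum (fun i => z (i + d))) sqsum_shift sqsumE -EFinM.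
  exact: sqr_ge0.
(* The estimates are summed over [i] and [k]. After exchanging the sums, the squared weights
   contribute [T] and their squared differences [g ^+ 2 * T], whatever [i] is. *)
have key : ((m ^+ 2 * T * r ^+ 2)%:E <=
   (cs * T * b ^+ 2 + ct * (g ^+ 2 * T) * r ^+ 2
    + cu * (g ^+ 2 * T) * r ^+ 2)%:E)%E.
  apply: (@le_trans _ _ (\esum_(i in [set: int]) \esum_(k in [set: int])
      (m ^+ 2 * nrm (x i) ^+ 2 * w (i - k) ^+ 2)%:E)).
    rewrite -(sqsum_scale _ _ x 0) ?(sqr_ge0, mulr_ge0, ltW T0)//.
    apply: le_esum => i _; rewrite addr0 wsum ?(sqr_ge0, mulr_ge0)//.
    by rewrite mulrAC.
  rewrite exchange_esum => [|i k]; last first.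
    by rewrite lee_fin !(sqr_ge0, mulr_ge0, nrm_ge0).
  apply: (le_trans (le_esum (fun k _ => lower k))).
  rewrite exchange_esum => [|i k]; last by rewrite lee_fin sqr_ge0.
  rewrite !EFinD -(sqsum_scale _ _ (B x) 0) ?mulr_ge0 ?(ltW T0)//.
  rewrite -(sqsum_scale _ _ x (- 1)) ?(sqr_ge0, mulr_ge0, ltW T0)//.
  rewrite -(sqsum_scale _ _ x 1) ?(sqr_ge0, mulr_ge0, ltW T0)//.
  rewrite -esumD; last 2 first.
  - by move=> i _; rewrite lee_fin !(sqr_ge0, mulr_ge0, nrm_ge0, ltW T0).
  - by move=> i _; rewrite lee_fin !(sqr_ge0, mulr_ge0, nrm_ge0, ltW T0).
  rewrite -esumD; last 2 first.
  - by move=> i _; rewrite adde_ge0// lee_fin !(sqr_ge0, mulr_ge0, nrm_ge0, ltW T0).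
  - by move=> i _; rewrite lee_fin !(sqr_ge0, mulr_ge0, nrm_ge0, ltW T0).
  apply: le_esum => i _; rewrite addr0.
  rewrite [X in (_ <= X%:E + _ + _)%E]mulrAC.
  rewrite [X in (_ <= _ + X%:E + _)%E]mulrAC [X in (_ <= _ + X%:E)%E]mulrAC.
  rewrite -(wsum i) ?(sqr_ge0, mulr_ge0)//.
  rewrite -(dwsum (i - 1)) ?(sqr_ge0, mulr_ge0)//.
  rewrite -(dwsum i) ?(sqr_ge0, mulr_ge0)//.
  rewrite -esumD; last 2 first.
  - by move=> k _; rewrite lee_fin !(sqr_ge0, mulr_ge0, nrm_ge0).
  - by move=> k _; rewrite lee_fin !(sqr_ge0, mulr_ge0, nrm_ge0).
  rewrite -esumD; last 2 first.
  - by move=> k _; rewrite adde_ge0// lee_fin !(sqr_ge0, mulr_ge0, nrm_ge0).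
  - by move=> k _; rewrite lee_fin !(sqr_ge0, mulr_ge0, nrm_ge0).
  by apply: le_esum => k _; rewrite -!EFinD lee_fin.
(* Each of [b], [p g r], [q g r] is at most its weight, so the three ratios add up to at most
   [s + t + u = S], which yields [S ^+ 2]. *)
have ratio_le (a c : R) : 0 <= a -> a <= c -> 0 < c -> a ^+ 2 / c <= c.
  move=> a0 ac c0; rewrite ler_pdivrMr// -expr2.
  by rewrite ler_pXn2r ?nnegrE// ltW.
rewrite -(@ler_pXn2r _ 2) ?nnegrE ?mulr_ge0 ?(ltW S0) ?(ltW r0)//.
rewrite -(ler_pM2l T0); move: key; rewrite lee_fin -csE -ctE -cuE => key.
apply: (@le_trans _ _
  (T * (S * (b ^+ 2 / s + (p * g * r) ^+ 2 / t + (q * g * r) ^+ 2 / u)))).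
  apply: le_trans (le_trans key _); first by rewrite exprMn mulrA [T * _]mulrC.
  rewrite le_eqVlt; apply/orP; left; apply/eqP; ring.
rewrite ler_pM2l// expr2 ler_pM2l// -[leRHS]SE !lerD// ratio_le//.
- by rewrite -sE lerDl ltW.
- by rewrite (mulr_ge0 (mulr_ge0 _ (ltW g0)) (ltW r0)).
- by rewrite -tE !ler_wpM2r ?(ltW g0) ?(ltW r0)// lerDl ltW.
- by rewrite (mulr_ge0 (mulr_ge0 _ (ltW g0)) (ltW r0)).
- by rewrite -uE !ler_wpM2r ?(ltW g0) ?(ltW r0)// lerDl ltW.
Qed.

End Localization.

(** * Lower norms, inverse norms and the inclusions *)

Section LowerNorm.
Variable R : realType.

Lemma le_lower_norm (V W : normedModType R[i]) (B : 'L(V, W)) (S : set V) (m : R) :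
  (forall x, S x -> m * nrm x <= nrm (B x)) -> (m%:E <= lower_norm B S)%E.
Proof.
move=> h; apply: le_ereal_inf_tmp => _ [x [Sx x1] <-].
by rewrite lee_fin -[m]mulr1 -x1 h.
Qed.

Lemma lower_norm_le (V W : normedModType R[i]) (B : 'L(V, W)) (S : set V) (m : R) :
  (forall (t : R) x, S x -> S (t%:C *: x)) -> (m%:E <= lower_norm B S)%E ->
  forall x, S x -> m * nrm x <= nrm (B x).
Proof.
move=> SZ mB x Sx; have [x0|xN0] := eqVneq (nrm x) 0.
  by rewrite x0 mulr0 nrm_ge0.
have x_gt0 : 0 < nrm x by rewrite lt_neqAle eq_sym xN0 nrm_ge0.
pose t := (nrm x)^-1; have t0 : 0 <= t by rewrite invr_ge0 nrm_ge0.
suff : m <= nrm (B (t%:C *: x)).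
  by rewrite linearZ /= nrmZr ger0_norm// ler_pdivlMl// mulrC.
rewrite -lee_fin (le_trans mB)//; apply: ereal_inf_lbound; exists (t%:C *: x) => //.
by split; [exact: SZ|rewrite nrmZr ger0_norm// mulVf].
Qed.

(** Homogeneity replaces unit vectors by all vectors; this form also covers windows without unit
    vectors, where the lower norm is [+oo]. *)
Lemma le_muP (V : normedModType R[i]) (n : nat) (A : tridiag V) (m : R) :
  (m%:E <= mu n A)%E <->
  (forall k x, supported_in n k x -> m * nrm x <= nrm (tridiag_op A x)) /\
  (forall k y, supported_in n k y ->
     m * nrm y <= nrm (tridiag_op (tridiag_adj A) y)).
Proof.
have SZ (U : normedModType R[i]) k (t : R) (x : l2 U) :
    supported_in n k x -> supported_in n k (t%:C *: x).
  by move=> xk j /xk h; rewrite l2_scaleE h scaler0.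
split=> [mA|[mA mA']]; last first.
  apply: le_ereal_inf_tmp => _ [k _ <-]; rewrite le_min.
  by rewrite !le_lower_norm//; [exact: mA'|exact: mA].
have h k : (m%:E <= lower_norm (tridiag_op A) (supported_in n k))%E /\
    (m%:E <= lower_norm (tridiag_op (tridiag_adj A)) (supported_in n k))%E.
  apply/andP; rewrite -le_min (le_trans mA)//.
  by apply: ereal_inf_lbound; exists k.
split=> k; apply: lower_norm_le; first exact: SZ.
- by have [] := h k.
- exact: SZ.
- by have [] := h k.
Qed.

End LowerNorm.

(** * Reciprocals of inverse norms *)

Section InverseNorm.
Variables (R : realType) (V : normedModType R[i]).
Implicit Types (B C : 'L(V)) (e m : R).

Lemma inv_normE B C : is_inverse B C -> inv_norm B = (nrm C)%:E.
Proof.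
move=> BC; rewrite /inv_norm; case: pselect => [h|]; last by case; exists C.
congr (nrm _)%:E; case: (cid h) => C' [/= _ BC'].
by apply: bop_ext => x; rewrite -{1}(BC.2 x) -(BC.1 (C' _)) BC' -(BC.2 x) BC.1.
Qed.

Lemma le_inv_normV B C m : is_inverse B C -> m * nrm C <= 1 ->
  (m%:E <= (inv_norm B)^-1)%E.
Proof.
(* [nrm C = 0] happens only on the trivial space; the reciprocal is then [+oo]. *)
move=> BC mC; rewrite (inv_normE BC) inver; case: eqVneq => [_|C0].
  exact: leey.
have C_gt0 : 0 < nrm C by rewrite lt_neqAle eq_sym C0 nrm_ge0.
by rewrite lee_fin -[_^-1]mul1r ler_pdivlMr.
Qed.

Lemma inv_normV_invertible B : (0%:E < (inv_norm B)^-1)%E -> invertible B.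
Proof.
by rewrite /inv_norm; case: pselect => [//|_]; rewrite invey ltxx.
Qed.

Lemma le_inv_normV_inverse B e : 0 < e -> (e%:E <= (inv_norm B)^-1)%E ->
  exists2 C, is_inverse B C & e * nrm C <= 1.
Proof.
move=> e0 eB; have [|C BC] := @inv_normV_invertible B.
  by apply: lt_le_trans eB; rewrite lte_fin.
exists C => //; move: eB; rewrite (inv_normE BC) inver.
have [->|C0] := eqVneq (nrm C) 0; first by rewrite mulr0 ler01.
have C_gt0 : 0 < nrm C by rewrite lt_neqAle eq_sym C0 nrm_ge0.
by rewrite lee_fin -[_^-1]mul1r ler_pdivlMr.
Qed.

(** The strict inequality leaves room for a real [m > e]: [1 / |C|], or [e + 1] in the degenerate
    case [|C| = 0]. *)
Lemma lt_inv_normV_inverse B e : 0 <= e -> (e%:E < (inv_norm B)^-1)%E ->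
  exists m C, [/\ e < m, is_inverse B C & m * nrm C <= 1].
Proof.
move=> e0 eB; have [|C BC] := @inv_normV_invertible B.
  by apply: le_lt_trans eB; rewrite lee_fin.
move: eB; rewrite (inv_normE BC) inver.
have [C0|C0] := eqVneq (nrm C) 0 => eC.
  by exists (e + 1), C; split; rewrite ?C0 ?mulr0 ?ler01 ?ltrDl.
by exists (nrm C)^-1, C; split; rewrite ?mulVf.
Qed.

End InverseNorm.

(** * Contrapositive forms of the inclusions *)

Section Inclusions.
Variables (R : realType) (V : normedModType R[i]) (n : nat).

(** For the left inclusions: the inverse bounds the operator below everywhere, and its adjoint on
    every window. *)
Lemma inverse_le_mu (A : tridiag V) (C : 'L(l2 V)) (m : R) : 0 <= m ->
  is_inverse (tridiag_op A) C -> m * nrm C <= 1 -> (m%:E <= mu n A)%E.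
Proof.
move=> m0 AC mC.
have bound (U : normedModType R[i]) (u v : U) : nrm u <= nrm C * nrm v ->
    m * nrm u <= nrm v.
  move=> /(ler_wpM2l m0) /le_trans; apply; rewrite mulrA.
  by rewrite ler_piMl ?nrm_ge0.
apply/le_muP; split => [k x _|k y yk].
  by apply: bound; rewrite -{1}(AC.1 x); exact: opnormP.
apply: bound; apply: (inverse_bounds_adjoint AC (window_seq_uniq n k)) => j.
by rewrite mem_window_seq; exact: yk.
Qed.

(** For the right inclusions: localization costs [eps2 n A], both for the operator and for its
    adjoint, and leaves the lower bound [c] for each. *)
Lemma mu_inverse (A : tridiag V) (c : R) : nrm_complete V -> (0 < n)%N ->
  0 < c -> ((c + eps2 n A)%:E <= mu n A)%E ->
  exists2 C, is_inverse (tridiag_op A) C & c * nrm C <= 1.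
Proof.
move=> V_complete n0 c0 /le_muP[hA hA'].
set a := sup_norm (alpha A); set g := sup_norm (gamma A).
have a0 : 0 <= a by exact: sup_norm_ge0 (alpha_bounded A).
have g0 : 0 <= g by exact: sup_norm_ge0 (gamma_bounded A).
have epsE : eps2 n A = (a + g) * sine_gap R n.
  by rewrite /eps2 /sine_gap mulrA [_ * 2]mulrC.
have m0 : 0 <= c + eps2 n A.
  by rewrite epsE addr_ge0 ?(ltW c0)// mulr_ge0 ?addr_ge0// ltW// sine_gap_gt0.
have [C AC Cc] : exists2 C, is_inverse (tridiag_op A) C & nrm C <= c^-1.
  apply: tridiag_inverse => // [x|y].
    have := window_bound n0 m0 (p := a) (q := g) _ _ hA x.
    rewrite epsE addrK; apply=> j.
      exact: sup_norm_ub (alpha_bounded A).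
    exact: sup_norm_ub (gamma_bounded A).
  (* In the adjoint matrix the two off-diagonals trade places, and so do their bounds. *)
  have := window_bound n0 m0 (p := g) (q := a) _ _ hA' y.
  rewrite epsE [g + a]addrC addrK; apply=> j; apply: le_trans (opnorm_adj _) _.
    exact: sup_norm_ub (gamma_bounded A).
  exact: sup_norm_ub (alpha_bounded A).
by exists C => //; rewrite mulrC -ler_pdivlMr// mul1r.
Qed.

End Inclusions.

Unset Implicit Arguments.
Set Strict Implicit.

Theorem corollary5p4 (R : realType) (X : completeNormedModType R[i])
    (A : tridiag X) (n : nat) (hn : (0 < n)%N) :
  (forall eps : R, 0 <= eps ->
     Gamma_set n eps A `<=` Spec_ eps (tridiag_op A) /\
     Spec_ eps (tridiag_op A) `<=` Gamma_set n (eps + eps2 n A) A) /\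
  (forall eps : R, 0 < eps ->
     gamma_set n eps A `<=` spec_ eps (tridiag_op A) /\
     spec_ eps (tridiag_op A) `<=` gamma_set n (eps + eps2 n A) A).
Proof.
have X_complete := @completeP R X.
(* Subtracting a scalar changes only [beta], which does not enter [eps2]. *)
have epsE l : eps2 n (tridiag_sub A l) = eps2 n A by [].
split=> eps eps0; split=> l; rewrite /Gamma_set /gamma_set /Spec_ /spec_ /=.
- move=> mu_le; case: eqVneq => [eps00 [C AC]|epsN0] /=.
    move: AC mu_le; rewrite -tridiag_op_sub eps00 => AC.
    apply/negP; rewrite -ltNge.
    (* Adding [1] allows for [nrm C = 0]; invertibility thus makes [mu] strictly positive. *)
    have C1 : 0 < nrm C + 1 by rewrite ltr_wpDl ?nrm_ge0.
    apply: (@lt_le_trans _ _ ((nrm C + 1)^-1)%:E).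
      by rewrite lte_fin invr_gt0.
    apply: (inverse_le_mu n _ AC); first by rewrite invr_ge0 ltW.
    by rewrite mulrC ler_pdivrMr// mul1r lerDl.
  rewrite leNgt; apply/negP => /(lt_inv_normV_inverse eps0)[m [C [em]]].
  rewrite -tridiag_op_sub => AC mC.
  have := inverse_le_mu n (le_trans eps0 (ltW em)) AC mC.
  by move=> /le_trans /(_ mu_le); rewrite lee_fin leNgt em.
- move=> l_spec; rewrite -(epsE l) leNgt; apply/negP => lt_mu.
  (* The strict margin makes [m] positive even for [eps = 0], and contradicts the non-strict
     inequality of the closed pseudospectrum. If [mu] is [+oo], any [m > eps] serves. *)
  have [m em mmu] : exists2 m : R, eps < m &
      ((m + eps2 n (tridiag_sub A l))%:E <= mu n (tridiag_sub A l))%E.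
    move: lt_mu; case: mu => [r|_|//].
      rewrite lte_fin => h; exists (r - eps2 n (tridiag_sub A l)); first by rewrite ltrBrDr.
      by rewrite subrK.
    by exists (eps + 1); [rewrite ltrDl|exact: leey].
  have m0 : 0 < m by exact: le_lt_trans em.
  have [C] := mu_inverse X_complete hn m0 mmu.
  rewrite tridiag_op_sub => AC mC.
  move: l_spec; case: eqVneq => [_|_] /=; first by apply; exists C.
  by apply/negP; rewrite -ltNge (lt_le_trans _ (le_inv_normV AC mC))// lte_fin.
- move=> mu_lt; rewrite ltNge; apply/negP => /(le_inv_normV_inverse eps0)[C].
  rewrite -tridiag_op_sub => AC mC.
  have := inverse_le_mu n (ltW eps0) AC mC.
  by rewrite leNgt mu_lt.
(* For the open sets the assumption is strict, so [c = eps] itself leads to a contradiction. *)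
- move=> l_spec; rewrite -(epsE l) ltNge; apply/negP => /(mu_inverse X_complete hn eps0)[C].
  rewrite tridiag_op_sub => AC mC.
  by have := le_inv_normV AC mC; rewrite leNgt l_spec.
Qed.
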